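(* Let $(M,F)$ be an $n$-dimensional Finsler manifold of scalar curvature, with flag curvature $\mathbf K=\mathbf K(x,y)$. Suppose that the S-curvature is isotropic, i.e. $$\mathbf S(x,y)=(n+1)\,c(x)\,F(x,y)\qquad (x\in M,\ y\in T_xM\setminus\{0\}),$$ where $c=c(x)$ is a scalar function on $M$. Then there is a scalar function $\sigma(x)$ on $M$ such that $$\mathbf K(x,y)=3\,\frac{c_{x^m}(x)\,y^m}{F(x,y)}+\sigma(x).$$ In particular, $c(x)=c$ is a constant if and only if $\mathbf K=\mathbf K(x)$ is a scalar function on $M$ (i.e. is independent of $y$).
   Context: Manifolds are smooth, connected, of dimension $n\ge 2$. A scalar function on $M$ is a $C^\infty$ real-valued function on $M$. A Finsler metric $F:TM\to[0,\infty)$ is $C^\infty$ on $TM\setminus\{0\}$, positively homogeneous of degree one in $y$ (i.e. $F(x,ty)=tF(x,y)$ for $t>0$; reversibility is not assumed), and such that $g_{ij}(x,y)=\frac12[F^2]_{y^iy^j}(x,y)$ is positive definite for $y\neq 0$. Subscripts $x^m$, $y^k$ denote partial derivatives in standard local coordinates $(x^i,y^i)$ of $TM$; $(g^{ij})=(g_{ij})^{-1}$; repeated indices are summed. Geodesic coefficients: $G^i=\frac14 g^{il}\{[F^2]_{x^ky^l}y^k-[F^2]_{x^l}\}$; geodesics $\gamma$ of $F$ are the solutions of $\ddot \gamma^i+2G^i(\gamma,\dot \gamma)=0$. Riemann curvature: $K^i_{\ k}=2\frac{\partial G^i}{\partial x^k}-y^j\frac{\partial^2G^i}{\partial x^j\partial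 y^k}+2G^j\frac{\partial^2G^i}{\partial y^j\partial y^k}-\frac{\partial G^i}{\partial y^j}\frac{\partial G^j}{\partial y^k}$, and $\mathbf K_y(u)=K^i_{\ k}u^k\,\partial/\partial x^i$. For a plane $P=\mathrm{span}\{y,u\}\subset T_xM$, the flag curvature is $$\mathbf K(P,y)=\frac{\mathbf g_y(u,\mathbf K_y(u))}{\mathbf g_y(y,y)\mathbf g_y(u,u)-\mathbf g_y(y,u)^2},\qquad \mathbf g_y=g_{ij}(x,y)\,dx^i\otimes dx^j .$$ $F$ is of scalar curvature if $\mathbf K(P,y)$ does not depend on the plane $P$ containing $y$, so that $\mathbf K=\mathbf K(x,y)$ is a function on $TM\setminus\{0\}$. Distortion: $\tau(x,y)=\ln\Big[\frac{\sqrt{\det(g_{ij}(x,y))}}{\mathrm{Vol}(\mathrm B^n(1))}\cdot \mathrm{Vol}\{(y^i)\in\mathbb R^n: F(y^i\,\partial/\partial x^i|_x)<1\}\Big]$, where $\mathrm{Vol}$ is Euclidean volume and $\mathrm B^n(1)$ the Euclidean unit ball. S-curvature: $\mathbf S(x,y)=\frac{d}{dt}\big[\tau(\gamma(t),\dot\gamma(t))\big]_{t=0}$, where $\gamma$ is the geodesic of $F$ with $\gamma(0)=x$, $\dot\gamma(0)=y$. *)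

(* Defs.v *)
From HB Require Import structures.
From mathcomp Require Import all_boot all_order all_algebra.
From mathcomp Require Import all_classical all_reals all_analysis.
Set Implicit Arguments.
Unset Strict Implicit.
Unset Printing Implicit Defensive.
Import Order.TTheory GRing.Theory Num.Theory.
Import numFieldNormedType.Exports.
Local Open Scope classical_set_scope.
Local Open Scope ring_scope.

(** * Smooth maps on open subsets of finite-dimensional spaces *)

Fixpoint Ck (R : realType) (V W : normedModType R) (k : nat)
    (U : set V) (f : V -> W) : Prop :=
  match k with
  | 0 => forall x, U x -> {for x, continuous f}
  | k'.+1 => (forall x, U x -> differentiable f x) /\
             (forall v : V, Ck k' U ('D_v f))
  end.

Definition smooth_on (R : realType) (V W : normedModType R)
    (U : set V) (f : V -> W) : Prop := forall k, Ck k U f.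

Definition partial (R : realType) (n : nat) (m : 'I_n)
    (f : 'rV[R]_n -> R) (x : 'rV[R]_n) : R := 'D_(delta_mx 0 m) f x.

(** * Manifolds *)

(* [chart_inv] is only meaningful on the image [phi @` chart_dom phi]. *)
Record chart (R : realType) (n : nat) (M : topologicalType) := Chart {
  chart_dom : set M ;
  chart_map :> M -> 'rV[R]_n ;
  chart_inv : 'rV[R]_n -> M ;
  chart_dom_open : open chart_dom ;
  chart_img_open : open (chart_map @` chart_dom) ;
  chart_mapK : forall p, chart_dom p -> chart_inv (chart_map p) = p ;
  chart_map_cont : forall p, chart_dom p -> {for p, continuous chart_map} ;
  chart_inv_cont : forall x, (chart_map @` chart_dom) x ->
    {for x, continuous chart_inv} }.

Definition chart_img (R : realType) (n : nat) (M : topologicalType)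
    (phi : chart R n M) : set 'rV[R]_n := phi @` chart_dom phi.

Definition transition (R : realType) (n : nat) (M : topologicalType)
    (phi psi : chart R n M) (x : 'rV[R]_n) : 'rV[R]_n :=
  psi (chart_inv phi x).

(* [chart_at p] is an arbitrary chart around [p], used only to represent the
   tangent space at [p] concretely. *)
Record manifold (R : realType) (n : nat) := Manifold {
  carrier :> topologicalType ;
  atlas : set (chart R n carrier) ;
  chart_at : carrier -> chart R n carrier ;
  chart_at_atlas : forall p, atlas (chart_at p) ;
  chart_at_dom : forall p, chart_dom (chart_at p) p ;
  atlas_smooth : forall phi psi, atlas phi -> atlas psi ->
    smooth_on (phi @` (chart_dom phi `&` chart_dom psi)) (transition phi psi) ;
  manifold_hausdorff : hausdorff_space carrier ;
  manifold_second_countable : @second_countable carrier ;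
  manifold_connected : connected [set: carrier] }.

Definition smooth_function (R : realType) (n : nat) (M : manifold R n)
    (f : M -> R) : Prop :=
  forall phi, atlas phi -> smooth_on (chart_img phi) (f \o chart_inv phi).

(* The tangent space at [p] is R^n, a vector being identified with its
   components in the chart [chart_at p]; components in the other charts
   follow from the usual transformation rule. *)
Definition tangent (R : realType) (n : nat) (M : manifold R n) (p : M) :=
  'rV[R]_n.

Definition tangent_coord (R : realType) (n : nat) (M : manifold R n)
    (phi : chart R n M) (p : M) (y : tangent p) : 'rV[R]_n :=
  'd (transition (chart_at p) phi) (chart_at p p) y.

Definition tangent_of_coord (R : realType) (n : nat) (M : manifold R n)
    (phi : chart R n M) (p : M) (v : 'rV[R]_n) : tangent p :=
  'd (transition phi (chart_at p)) (phi p) v.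

(* The expression F(x, y) in the coordinates (x^i, y^i) of TM induced by
   [phi]. *)
Definition local_expr (R : realType) (n : nat) (M : manifold R n)
    (F : forall p : M, tangent p -> R) (phi : chart R n M)
    (x y : 'rV[R]_n) : R :=
  F (chart_inv phi x) (tangent_of_coord phi (chart_inv phi x) y).

(** * Finsler geometry in local coordinates *)

Section LocalFinsler.
Variables (R : realType) (n : nat).
Implicit Types (f L : 'rV[R]_n -> 'rV[R]_n -> R) (x y u v : 'rV[R]_n).

Definition dx (m : 'I_n) f x y : R := partial m (fun x' => f x' y) x.
Definition dy (m : 'I_n) f x y : R := partial m (f x) y.

Definition sqF L x y : R := L x y ^+ 2.

Definition gmx L x y : 'M[R]_n :=
  \matrix_(i, j) (2^-1 * dy j (dy i (sqF L)) x y).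

Definition ginner L x y u v : R :=
  \sum_i \sum_j gmx L x y i j * u 0 i * v 0 j.

Definition spray L (i : 'I_n) x y : R :=
  4^-1 * \sum_l invmx (gmx L x y) i l *
    ((\sum_k dy l (dx k (sqF L)) x y * y 0 k) - dx l (sqF L) x y).

Definition riemann L (i k : 'I_n) x y : R :=
  2 * dx k (spray L i) x y
  - \sum_j y 0 j * dx j (dy k (spray L i)) x y
  + 2 * (\sum_j spray L j x y * dy j (dy k (spray L i)) x y)
  - \sum_j dy j (spray L i) x y * dy k (spray L j) x y.

Definition riemann_map L x y u : 'rV[R]_n :=
  \row_i \sum_k riemann L i k x y * u 0 k.

Definition flag_curvature L x y u : R :=
  ginner L x y u (riemann_map L x y u) /
  (ginner L x y y y * ginner L x y u u - ginner L x y y u ^+ 2).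

Definition closed_box (a b : 'rV[R]_n) : set 'rV[R]_n :=
  [set y | forall i, a 0 i <= y 0 i <= b 0 i].

(* n-dimensional Lebesgue outer measure; only applied to open sets below *)
Definition vol (A : set 'rV[R]_n) : \bar R :=
  ereal_inf [set v | exists a b : nat -> 'rV[R]_n,
    [/\ forall k i, a k 0 i <= b k 0 i,
        A `<=` \bigcup_k closed_box (a k) (b k) &
        v = (\sum_(0 <= k <oo) (\prod_i (b k 0 i - a k 0 i))%:E)%E]].

Definition unit_ball : set 'rV[R]_n := [set y | \sum_i y 0 i ^+ 2 < 1].

Definition distortion L x y : R :=
  ln (Num.sqrt (\det (gmx L x y)) / fine (vol unit_ball) *
      fine (vol [set v | L x v < 1])).

Definition geodesic_near0 (U : set 'rV[R]_n) L (gamma : R -> 'rV[R]_n) : Prop :=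
  \forall t \near (0 : R),
    [/\ U (gamma t), derivable gamma t 1, derivable (derive1 gamma) t 1 &
        forall i, derive1 (derive1 gamma) t 0 i
                  + 2 * spray L i (gamma t) (derive1 gamma t) = 0].

(* S(x, y) = s; the geodesic with given initial data is unique near t = 0 *)
Definition S_curvature_is (U : set 'rV[R]_n) L x y (s : R) : Prop :=
  exists gamma : R -> 'rV[R]_n,
    [/\ geodesic_near0 U L gamma, gamma 0 = x, derive1 gamma 0 = y &
        is_derive (0 : R) 1 (fun t => distortion L (gamma t) (derive1 gamma t)) s].

End LocalFinsler.

(** * Finsler manifolds *)

Record finsler (R : realType) (n : nat) (M : manifold R n) := Finsler {
  finsler_fun :> forall p : M, tangent p -> R ;
  finsler_ge0 : forall (p : M) (y : tangent p), 0 <= finsler_fun y ;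
  finsler_smooth : forall phi, atlas phi ->
    smooth_on [set z : 'rV[R]_n * 'rV[R]_n | chart_img phi z.1 /\ z.2 != 0]
      (fun z => local_expr finsler_fun phi z.1 z.2) ;
  finsler_homog : forall (p : M) (y : tangent p) (t : R), 0 < t ->
    finsler_fun (t *: y : tangent p) = t * finsler_fun y ;
  finsler_posdef : forall phi, atlas phi -> forall x y u : 'rV[R]_n,
    chart_img phi x -> y != 0 -> u != 0 ->
    0 < ginner (local_expr finsler_fun phi) x y u u }.

(* The flag curvature and the S-curvature do not depend on the coordinates;
   the predicates below prescribe their values in every chart of the atlas. *)

Definition has_scalar_curvature (R : realType) (n : nat) (M : manifold R n)
    (F : finsler M) (K : forall p : M, tangent p -> R) : Prop :=
  forall (p : M) (y u : tangent p) (phi : chart R n M),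
    atlas phi -> chart_dom phi p -> free [:: y; u] ->
    flag_curvature (local_expr F phi) (phi p)
      (tangent_coord phi y) (tangent_coord phi u) = K p y.

Definition has_S_curvature (R : realType) (n : nat) (M : manifold R n)
    (F : finsler M) (S : forall p : M, tangent p -> R) : Prop :=
  forall (p : M) (y : tangent p) (phi : chart R n M),
    atlas phi -> chart_dom phi p -> y != 0 ->
    S_curvature_is (chart_img phi) (local_expr F phi) (phi p)
      (tangent_coord phi y) (S p y).

(* c_{x^m}(x) y^m in the chart [phi] *)
Definition dir_deriv (R : realType) (n : nat) (M : manifold R n)
    (c : M -> R) (phi : chart R n M) (p : M) (y : tangent p) : R :=
  \sum_m partial m (c \o chart_inv phi) (phi p) * tangent_coord phi y 0 m.

(* Main.v *)
Require Import Defs.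
From HB Require Import structures.
From mathcomp Require Import all_boot all_order all_algebra.
From mathcomp Require Import all_classical all_reals all_analysis measurable_realfun.
From mathcomp Require Import ring lra.
Set Implicit Arguments.
Unset Strict Implicit.
Unset Printing Implicit Defensive.
Import Order.TTheory GRing.Theory Num.Theory.
Import numFieldNormedType.Exports.
Local Open Scope classical_set_scope.
Local Open Scope ring_scope.

(** Work in a chart and write [E = F^2/2], [Gam = y^k d/dx^k - 2 G^k d/dy^k] for
    the spray vector field, [N^i_k = dG^i/dy^k] and [Pi = N^m_m].  Smooth functions
    of [(x, y)], [y <> 0], form a commutative ring with commuting derivations
    [d/dx^i], [d/dy^i], in which the tensor identities are pure algebra.  The
    Euler-Lagrange identity [Gam E_{y^i} = E_{x^i}] makes [g_ij K^j_k] symmetric, so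
    that scalar flag curvature [K] means [K^i_k = K (F^2 delta^i_k - y^i E_{y^k})].
    Tracing the definition of the Riemann curvature gives
    [2 K^m_{k.m} + K^m_{m.k} = 3 (Pi_{x^k} - Gam Pi_{y^k})], whose left-hand side is
    [(n+1) K_{y^k} F^2].

    Up to a constant the distortion is [1/2 ln det g + V(x)], where [V] is the
    logarithm of the volume of the indicatrix, and [Gam (1/2 ln det g) = Pi].  As [V]
    is locally Lipschitz, its derivatives along geodesics, [S - Pi], are directional
    derivatives; so [S = Pi + V_{x^m} y^m] with [V] smooth, and the exact term drops
    out of the right-hand side above.  With [S = (n+1) c F] and [Gam F = 0] this
    leaves [K_{y^k} F^2 = 3 (c_{x^k} F - c_{x^m} y^m F_{y^k})]: the [y]-gradient of
    [K - 3 c_{x^m} y^m / F] vanishes on the connected set [y <> 0].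

    If moreover [K] does not depend on [y], then [c_{x^m} y^m = s F] for a number [s]
    depending on the point only; comparing [y] with [- y] gives [s = 0]. *)

(** * Derivations and sprays *)

(** The hypothesis on the S-curvature gives only the derivative of the distortion along one geodesic
    per initial vector, and nothing says beforehand that the volume of the indicatrix is
    differentiable. So the regularity of [V] is read off backwards: [S - Pi] is an explicit smooth
    expression, it is shown to be the directional derivative of [V], and this makes it linear in [y]
    with closed coefficients. Closedness is all that the curvature identity uses. The weights 2 and
    1 in that identity are those for which the terms [X m (N m k)] and the terms quadratic in [N]
    and its derivatives cancel, leaving [Pi] alone; their sum is the constant 3 of the theorem. With
    the same weights the undifferentiated multiples of [K] cancel on the left. The algebra is done
    over an abstract commutative ring, which need not be a domain, so 1/2, 1/F and the inverse of g
    enter as elements with their defining equations. *)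

Definition derivation (A : comPzRingType) (D : A -> A) : Prop :=
  (forall a b, D (a + b) = D a + D b) /\ (forall a b, D (a * b) = D a * b + a * D b).

Section Derivation.
Variables (A : comPzRingType) (D : A -> A) (DD : derivation D).

Lemma derD a b : D (a + b) = D a + D b. Proof. exact: DD.1. Qed.
Lemma derM a b : D (a * b) = D a * b + a * D b. Proof. exact: DD.2. Qed.

Lemma der0 : D 0 = 0.
Proof. by apply: (addrI (D 0)); rewrite -derD !addr0. Qed.

Lemma derN a : D (- a) = - D a.
Proof. by apply: (addrI (D a)); rewrite -derD !subrr der0. Qed.

Lemma derB a b : D (a - b) = D a - D b.
Proof. by rewrite derD derN. Qed.

Lemma der1 : D 1 = 0.
Proof. by apply: (addrI (D 1)); rewrite addr0 -{3}(mul1r 1) derM mul1r mulr1. Qed.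

Lemma derMn a k : D (a *+ k) = D a *+ k.
Proof. by elim: k => [|k IH]; rewrite ?mulr0n ?der0 // !mulrS derD IH. Qed.

Lemma der_nat k : D k%:R = 0.
Proof. by rewrite derMn der1 mul0rn. Qed.

Lemma der_sum I (r : seq I) (P : pred I) (f : I -> A) :
  D (\sum_(i <- r | P i) f i) = \sum_(i <- r | P i) D (f i).
Proof. exact: (big_morph D derD der0). Qed.

Lemma der_half (half : A) : half * 2 = 1 -> D half = 0.
Proof.
move=> h2; have : D (half * 2) = 0 by rewrite h2 der1.
rewrite derM der_nat mulr0 addr0 => e.
by rewrite -(mulr1 (D half)) -h2 mulrCA e mulr0.
Qed.

Lemma der_prod n (f : 'I_n -> A) :
  D (\prod_i f i) = \sum_i \prod_j (if j == i then D (f j) else f j).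
Proof.
elim: n f => [f|n IH f]; first by rewrite !big_ord0 der1.
rewrite big_ord_recl derM IH big_ord_recl; congr (_ + _).
  by rewrite big_ord_recl eqxx; congr (_ * _); apply: eq_bigr.
rewrite mulr_sumr; apply: eq_bigr => i _; rewrite big_ord_recl /=; congr (_ * _).
Qed.

Lemma der_mulmx m n p (P : 'M[A]_(m, n)) (Q : 'M[A]_(n, p)) :
  map_mx D (P *m Q) = map_mx D P *m Q + P *m map_mx D Q.
Proof.
apply/matrixP => i j; rewrite !mxE der_sum -big_split /=.
by apply: eq_bigr => k _; rewrite !mxE derM.
Qed.

(** Jacobi's formula: the product rule differentiates one row at a time, and expanding each
    resulting determinant along that row produces the cofactors. *)
Lemma der_det n (P : 'M[A]_n) : D (\det P) = \tr (\adj P *m map_mx D P).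
Proof.
rewrite mxtrace_mulC {1}/determinant der_sum /mxtrace.
transitivity (\sum_i \det (\matrix_(k, j) if k == i then D (P k j) else P k j)).
  rewrite exchange_big /=; apply: eq_bigr => s _; rewrite -mulr_sumr derM.
  have -> : D ((-1) ^+ perm.odd_perm s) = 0.
    by case: (perm.odd_perm s); rewrite ?expr1 ?expr0 ?derN der1 ?oppr0.
  rewrite mul0r add0r der_prod; congr (_ * _); apply: eq_bigr => i _.
  by apply: eq_bigr => k _; rewrite mxE.
apply: eq_bigr => i _; rewrite (expand_det_row _ i) mxE.
apply: eq_bigr => j _; rewrite !mxE eqxx; congr (_ * _).
rewrite /cofactor; congr (_ * \det _); apply/matrixP => k l; rewrite !mxE.
by rewrite eq_sym (negbTE (neq_lift _ _)).
Qed.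
End Derivation.

Section SprayAlgebra.
Variables (A : comPzRingType) (n : nat) (X Y : 'I_n -> A -> A).
Hypotheses (XD : forall i, derivation (X i)) (YD : forall i, derivation (Y i)).
Hypotheses (XX : forall i j a, X i (X j a) = X j (X i a)).
Hypotheses (XY : forall i j a, X i (Y j a) = Y j (X i a)).
Hypotheses (YY : forall i j a, Y i (Y j a) = Y j (Y i a)).
Variables (y : 'I_n -> A).
Hypotheses (Xy : forall i j, X i (y j) = 0).
Hypotheses (Yy : forall i j, Y i (y j) = (i == j)%:R).
Variables (half : A) (h2 : half * 2 = 1).

(** * Identities for an arbitrary spray *)

Section AnySpray.
Variable G : 'I_n -> A.

Definition Gam (a : A) : A :=
  \sum_k y k * X k a - 2 * \sum_k G k * Y k a.

Definition conn : 'M[A]_n := \matrix_(i, k) Y k (G i).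

Definition jac : 'M[A]_n :=
  2 *: (\matrix_(i, k) X k (G i)) - map_mx Gam conn - conn *m conn.

Lemma Gam_derivation : derivation Gam.
Proof.
split=> a b; rewrite /Gam.
  under eq_bigr do rewrite derD // mulrDr.
  under [in X in _ - X]eq_bigr do rewrite derD // mulrDr.
  rewrite !big_split /=; ring.
under eq_bigr do rewrite derM // mulrDr mulrA (mulrCA (y _)).
under [in X in _ - X]eq_bigr do rewrite derM // mulrDr mulrA (mulrCA (G _)).
rewrite !big_split /= -!mulr_suml -!mulr_sumr; ring.
Qed.

Lemma Y_Gam k a : Y k (Gam a) = Gam (Y k a) + X k a - 2 * \sum_j conn j k * Y j a.
Proof.
rewrite /Gam (derB (YD k)) (derM (YD k)) (der_nat (YD k)) mul0r add0r.
rewrite !(der_sum (YD k)).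
under eq_bigr do rewrite (derM (YD k)) Yy -XY.
under [X in _ - 2 * X = _]eq_bigr do rewrite (derM (YD k)) YY.
rewrite !big_split /= (bigD1 k) //= eqxx mul1r big1 ?addr0; last first.
  by move=> j; rewrite eq_sym => /negbTE ->; rewrite mul0r.
under [X in _ = _ - 2 * X]eq_bigr do rewrite mxE.
ring.
Qed.

Lemma X_Gam k a : X k (Gam a) = Gam (X k a) - 2 * \sum_j X k (G j) * Y j a.
Proof.
rewrite /Gam (derB (XD k)) (derM (XD k)) (der_nat (XD k)) mul0r add0r.
rewrite !(der_sum (XD k)).
under eq_bigr do rewrite (derM (XD k)) Xy XX mul0r add0r.
under [X in _ - 2 * X = _]eq_bigr do rewrite (derM (XD k)) XY.
rewrite !big_split /=; ring.
Qed.

Let Pi := \tr conn.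

(* The right-hand side is, up to sign, the Euler-Lagrange expression of [Pi]
   along the spray, which is computed independently from the S-curvature. *)
Lemma jac_trace k :
  2 * (\sum_m Y m (jac m k)) + Y k (\tr jac) = 3 * (X k Pi - Gam (Y k Pi)).
Proof.
have GD := Gam_derivation.
have jE i l : jac i l = 2 * X l (G i) - Gam (conn i l) - \sum_j conn i j * conn j l.
  by rewrite !mxE.
have YPi l : Y l Pi = \sum_m Y l (conn m m) by rewrite /Pi /mxtrace (der_sum (YD l)).
have XPi l : X l Pi = \sum_m X l (conn m m) by rewrite /Pi /mxtrace (der_sum (XD l)).
have YconnC i j l : Y l (conn i j) = Y j (conn i l) by rewrite !mxE YY.
rewrite /mxtrace (der_sum (YD k)) XPi.
under eq_bigr => m _.
  rewrite jE 2!(derB (YD m)) (derM (YD m)) (der_nat (YD m)) mul0r add0r Y_Gam.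
  rewrite (der_sum (YD m)).
  under [\sum_j Y m _]eq_bigr do rewrite (derM (YD m)).
  rewrite big_split /= -XY.
  over.
under [X in _ + X = _]eq_bigr => m _.
  rewrite jE 2!(derB (YD k)) (derM (YD k)) (der_nat (YD k)) mul0r add0r Y_Gam.
  rewrite (der_sum (YD k)).
  under [\sum_j Y k _]eq_bigr do rewrite (derM (YD k)).
  rewrite big_split /= -XY.
  over.
rewrite YPi !(der_sum GD) !big_split /= !sumrN -!mulr_sumr !big_split /= !sumrN.
rewrite -!mulr_sumr.
have e1 : \sum_i X k (Y i (G i)) = \sum_i X k (conn i i).
  by apply: eq_bigr => i _; rewrite mxE.
have e2 : \sum_i X i (Y k (G i)) = \sum_i X i (conn i k).
  by apply: eq_bigr => i _; rewrite mxE.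
have e3 (Z : 'I_n -> A -> A) (z : 'I_n -> A) :
    \sum_i \sum_j z j * Z j (Y i (conn i k)) = \sum_i \sum_j z j * Z j (Y k (conn i i)).
  by apply: eq_bigr => i _; apply: eq_bigr => j _; rewrite YconnC.
set P1 := \sum_i \sum_j conn i j * Y i (conn j k).
have e4 : \sum_i \sum_j conn j i * Y j (conn i k) = P1.
  by rewrite exchange_big.
set P2 := \sum_i \sum_j Y i (conn i j) * conn j k.
have e5 : \sum_i \sum_j conn j k * Y j (conn i i) = P2.
  by apply: eq_bigr => i _; apply: eq_bigr => j _; rewrite mulrC YconnC.
have e6 : \sum_i \sum_j conn i j * Y k (conn j i) = P1.
  by apply: eq_bigr => i _; apply: eq_bigr => j _; rewrite YconnC.
have e7 : \sum_i \sum_j Y k (conn i j) * conn j i = P1.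
  rewrite exchange_big; apply: eq_bigr => i _; apply: eq_bigr => j _.
  by rewrite mulrC YconnC.
rewrite e1 e2 !e3 e4 e5 e6 e7.
ring.
Qed.

End AnySpray.

(** * The geodesic spray of a metric *)

Section FinslerSpray.
Variables (L : A) (h : 'I_n -> 'I_n -> A).

Definition mom i := half * Y i (L * L).
Definition fund : 'M[A]_n := \matrix_(i, j) (half * Y j (Y i (L * L))).
Hypothesis fund_h : forall i j, \sum_k fund i k * h k j = (i == j)%:R.

Definition geod i : A :=
  half * half * \sum_l h i l * ((\sum_k Y l (X k (L * L)) * y k) - X l (L * L)).

Local Notation Gm := (Gam geod).
Let GD := Gam_derivation geod.
Let H : 'M[A]_n := \matrix_(i, k) X k (mom i).

Lemma fundE i k : fund i k = Y k (mom i).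
Proof. by rewrite mxE /mom (derM (YD k)) (der_half (YD k) h2) mul0r add0r. Qed.

Lemma tr_fund : fund^T = fund.
Proof. by apply/matrixP => i j; rewrite !mxE YY. Qed.

Lemma fundC i j : fund i j = fund j i.
Proof. by rewrite -{1}tr_fund mxE. Qed.

Lemma mul_half2 (a b : A) : a * 2 = b * 2 -> a = b.
Proof.
by move=> e; rewrite -(mulr1 a) -(mulr1 b) -h2 (mulrC half) !mulrA e.
Qed.

Lemma fund_geod i : 2 * (\sum_k geod k * fund i k) =
  \sum_k y k * X k (mom i) - half * X i (L * L).
Proof.
pose b l := (\sum_k Y l (X k (L * L)) * y k) - X l (L * L).
have -> : \sum_k geod k * fund i k = half * half * b i.
  transitivity (half * half * \sum_k \sum_l fund i k * h k l * b l).
    rewrite mulr_sumr; apply: eq_bigr => k _; rewrite /geod -mulrA; congr (_ * _).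
    rewrite mulr_suml; apply: eq_bigr => l _; rewrite -/(b l); ring.
  rewrite exchange_big; congr (_ * _).
  under eq_bigr do rewrite -mulr_suml fund_h.
  by rewrite (bigD1 i) //= eqxx mul1r big1 ?addr0 // => j /negbTE ne;
    rewrite eq_sym ne mul0r.
have -> : \sum_k y k * X k (mom i) = half * \sum_k Y i (X k (L * L)) * y k.
  rewrite mulr_sumr; apply: eq_bigr => k _.
  by rewrite /mom (derM (XD k)) (der_half (XD k) h2) mul0r add0r XY; ring.
by rewrite -mulrBr -/(b i) !mulrA (mulrC 2) h2 mul1r.
Qed.

Lemma Gam_mom i : Gm (mom i) = half * X i (L * L).
Proof.
rewrite /Gam; have := fund_geod i.
under eq_bigr do rewrite fundE.
by move=> ->; ring.
Qed.

Lemma X_Gam_sym i k : X k (Gm (mom i)) = X i (Gm (mom k)).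
Proof.
rewrite !Gam_mom; set q := L * L.
by rewrite (derM (XD k)) (derM (XD i)) (der_half (XD k) h2)
  (der_half (XD i) h2) !mul0r XX.
Qed.

Lemma Y_Gam_mom i k : Y k (Gm (mom i)) = H k i.
Proof.
rewrite Gam_mom mxE /mom; set q := L * L.
by rewrite (derM (YD k)) (derM (XD i)) (der_half (XD i) h2)
  (der_half (YD k) h2) !mul0r XY.
Qed.

Local Notation N := (conn geod).
Local Notation J := (\matrix_(i, k) X k (geod i) : 'M[A]_n).

Lemma subr_imp_eq (a b a' b' : A) : a - b = a' - b' -> a' = b' -> a = b.
Proof. by move=> e e'; apply/subr0_eq; rewrite e e' subrr. Qed.

(** Obtained by commuting [Y k] past [Gm] in the Euler-Lagrange equation [Gam_mom]. Its symmetric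
    part in [i], [k] is [Gam_fund], its skew part [H_skew]. *)
Lemma Gam_fund_H i k : Gm (fund i k) + H i k - 2 * (fund *m N) i k = H k i.
Proof.
rewrite -[RHS]Y_Gam_mom (Y_Gam geod k (mom i)) fundE; congr (_ + _ - 2 * _).
  by rewrite mxE.
by rewrite mxE; apply: eq_bigr => j _; rewrite fundE mulrC.
Qed.

(** Compatibility of the nonlinear connection with the metric: adding [Gam_fund_H] to its transpose
    cancels [H]. *)
Lemma Gam_fund i k : Gm (fund i k) = (fund *m N) i k + (fund *m N) k i.
Proof.
apply: mul_half2; have := Gam_fund_H k i; rewrite -(Gam_fund_H i k) (fundC k i).
by apply: subr_imp_eq; ring.
Qed.

Lemma Gam_fund_mx : map_mx Gm fund = fund *m N + trmx N *m fund.
Proof.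
have -> : trmx N *m fund = (fund *m N)^T by rewrite trmx_mul tr_fund.
by apply/matrixP => c d; rewrite mxE Gam_fund [RHS]mxE [X in _ = _ + X]mxE.
Qed.

Lemma H_skew i k : H i k - H k i = (fund *m N) i k - (fund *m N) k i.
Proof.
have := Gam_fund_H i k; rewrite Gam_fund.
by apply: subr_imp_eq; ring.
Qed.

(** By the Euler-Lagrange equation [X k (Gm (mom i))] is a second derivative of the energy, hence
    symmetric. Expanding it gives [Gm (H i k)] minus twice [fund *m J], and [H_skew] identifies the
    skew part of [H] with that of [fund *m N]. Applying [Gm] to the latter leaves, besides terms of
    [fund *m jac], only [N^T g N], which is symmetric by itself. *)
Lemma fund_jac_sym i k : (fund *m jac geod) i k = (fund *m jac geod) k i.
Proof.
have HJ a b : X b (Gm (mom a)) = Gm (H a b) - 2 * (fund *m J) a b.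
  rewrite X_Gam; congr (Gm _ - 2 * _); first by rewrite mxE.
  by rewrite mxE; apply: eq_bigr => j _; rewrite [(\matrix_(_, _) _) j b]mxE fundE mulrC.
have GN a b : Gm ((fund *m N) a b) =
    (fund *m N *m N) a b + (trmx N *m fund *m N) a b + (fund *m map_mx Gm N) a b.
  have := congr1 (fun P : 'M[A]_n => P a b) (der_mulmx GD fund N); rewrite mxE => ->.
  rewrite mxE; congr (_ + _).
  by rewrite Gam_fund_mx mulmxDl [LHS]mxE.
have JE a b : (fund *m jac geod) a b = 2 * (fund *m J) a b
    - (fund *m map_mx Gm N) a b - (fund *m N *m N) a b.
  by rewrite /jac !mulmxBr -scalemxAr mulmxA !mxE.
have sym : (trmx N *m fund *m N) i k = (trmx N *m fund *m N) k i.
  have e : (trmx N *m fund *m N)^T = trmx N *m fund *m N.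
    by rewrite !trmx_mul trmxK tr_fund mulmxA.
  by rewrite -{1}e mxE.
have := X_Gam_sym i k; rewrite !HJ.
have := congr1 Gm (H_skew i k); rewrite !(derB GD) !GN sym => e1 e2.
rewrite !JE; apply/subr0_eq.
move/eqP: e1; rewrite -subr_eq0 => /eqP e1.
move/eqP: e2; rewrite -subr_eq0 => /eqP e2.
by rewrite -[RHS](subrr 0) -{1}e1 -e2; ring.
Qed.

Lemma Gam_det : Gm (\det fund) = 2 * \tr N * \det fund.
Proof.
rewrite (der_det GD).
rewrite Gam_fund_mx.
rewrite mulmxDr mxtraceD mulmxA mul_adj_mx [X in _ + X]mxtrace_mulC -mulmxA mul_mx_adj.
by rewrite mul_scalar_mx mul_mx_scalar !mxtraceZ mxtrace_tr; ring.
Qed.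

Hypothesis Euler : \sum_i y i * Y i L = L.
Variable iL : A.
Hypothesis iLL : iL * L = 1.

Lemma momE i : mom i = L * Y i L.
Proof.
rewrite /mom (derM (YD i)) -[RHS]mul1r -h2; ring.
Qed.

Lemma y_mom : \sum_i y i * mom i = L * L.
Proof.
under eq_bigr do rewrite momE mulrCA.
by rewrite -mulr_sumr Euler.
Qed.

Lemma y_fund k : \sum_m y m * fund k m = mom k.
Proof.
have : Y k (\sum_m y m * mom m) = Y k (L * L) by rewrite y_mom.
rewrite (der_sum (YD k)).
under eq_bigr do rewrite (derM (YD k)) Yy -fundE fundC.
rewrite big_split /= (bigD1 k) //= eqxx mul1r big1 ?addr0; last first.
  by move=> i /negbTE ne; rewrite eq_sym ne mul0r.
have -> : Y k (L * L) = mom k + mom k.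
  by rewrite /mom -[LHS]mul1r -h2; ring.
by move/addrI.
Qed.

Lemma Gam_y i : Gm (y i) = - (2 * geod i).
Proof.
rewrite /Gam big1 ?sub0r => [|k _]; last by rewrite Xy mulr0.
congr (- (2 * _)); rewrite (bigD1 i) //= Yy eqxx mulr1 big1 ?addr0 // => k /negbTE e.
by rewrite Yy e mulr0.
Qed.

(** F is constant along its geodesics. Computing [Gm (L * L)] through [y_mom] and
    [half * Gm (L * L)] from the definition gives the same expression, so the quantity equals its
    own half. *)
Lemma Gam_L : Gm L = 0.
Proof.
have LI a : L * a = 0 -> a = 0 by move=> e; rewrite -(mul1r a) -iLL -mulrA e mulr0.
have e1 : Gm (L * L) = - (2 * \sum_i geod i * mom i) + half * \sum_i y i * X i (L * L).
  rewrite -{1}y_mom (der_sum GD) !mulr_sumr -sumrN -big_split /=.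
  by apply: eq_bigr => i _; rewrite (derM GD) Gam_y Gam_mom; ring.
have e2 : half * Gm (L * L) = half * \sum_i y i * X i (L * L) - 2 * \sum_i geod i * mom i.
  rewrite /Gam mulrBr; congr (_ - _); rewrite mulrCA; congr (_ * _).
  by rewrite mulr_sumr; apply: eq_bigr => i _; rewrite /mom mulrCA.
have e3 : half * Gm (L * L) = 0.
  have : Gm (L * L) = half * Gm (L * L) by rewrite e2 e1; ring.
  rewrite -{1}(mul1r (Gm _)) -h2 -mulrA mulrC => e.
  by apply: (addrI (half * Gm (L * L))); rewrite addr0 -{3}e; ring.
apply: LI; move: e3; rewrite (derM GD) => <-.
by rewrite -[LHS]mul1r -h2; ring.
Qed.

Lemma Gam_YL k : Gm (Y k L) = X k L.
Proof.
have e := Gam_mom k.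
rewrite momE (derM GD) Gam_L mul0r add0r (derM (XD k)) in e.
transitivity (iL * (L * Gm (Y k L))); first by rewrite mulrA iLL mul1r.
transitivity (half * 2 * (iL * L) * X k L); last by rewrite h2 iLL !mul1r.
by rewrite e; ring.
Qed.

Lemma h_fund i j : \sum_k h i k * fund k j = (i == j)%:R.
Proof.
have e : fund *m (\matrix_(i, j) h i j) = 1%:M.
  apply/matrixP => a b; rewrite mxE [RHS]mxE -fund_h.
  by apply: eq_bigr => k _; rewrite [X in _ * X]mxE.
have /matrixP/(_ i j) := mulmx1C e; rewrite mxE [RHS]mxE => <-.
by apply: eq_bigr => k _; rewrite [X in _ = X * _]mxE.
Qed.

(** The Euler operator: [euler a = r * a] says that [a] is homogeneous of degree r in y. The lemmas
    below follow the degree from the metric up to the curvature, so that the flag curvature comes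
    out of degree 0. *)
Definition euler (a : A) : A := \sum_i y i * Y i a.
Local Notation C := euler.

Lemma euler_derivation : derivation C.
Proof.
split=> a b; rewrite /euler.
  by under eq_bigr do rewrite derD // mulrDr; rewrite big_split.
under eq_bigr do rewrite derM // mulrDr mulrA (mulrCA (y _)).
by rewrite big_split /= -!mulr_suml -!mulr_sumr.
Qed.
Let CD := euler_derivation.

Lemma euler_y i : C (y i) = y i.
Proof.
rewrite /euler (bigD1 i) //= Yy eqxx mulr1 big1 ?addr0 // => k /negbTE e.
by rewrite Yy e mulr0.
Qed.

Lemma euler_Y k a : C (Y k a) = Y k (C a) - Y k a.
Proof.
rewrite /euler (der_sum (YD k)).
under [in RHS]eq_bigr do rewrite (derM (YD k)) Yy YY.
rewrite big_split /=.
have -> : \sum_i (k == i)%:R * Y i a = Y k a.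
  rewrite (bigD1 k) //= eqxx mul1r big1 ?addr0 // => i /negbTE e.
  by rewrite eq_sym e mul0r.
by rewrite addrC addrK.
Qed.

Lemma euler_X k a : C (X k a) = X k (C a).
Proof.
rewrite /euler (der_sum (XD k)); apply: eq_bigr => i _.
by rewrite (derM (XD k)) Xy mul0r add0r XY.
Qed.

Lemma euler_half : C half = 0.
Proof. exact: (der_half CD h2). Qed.

Lemma euler_LL : C (L * L) = 2 * (L * L).
Proof. by rewrite (derM CD) /euler Euler; ring. Qed.

Lemma euler_mom i : C (mom i) = mom i.
Proof.
rewrite /mom (derM CD) euler_half mul0r add0r euler_Y euler_LL (derM (YD i)) (der_nat (YD
  i)).
by ring.
Qed.

Lemma euler_fund i j : C (fund i j) = 0.
Proof. by rewrite fundE euler_Y euler_mom subrr. Qed.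

(** Differentiating [fund_h] shows that [fund] annihilates the derivative of [h]; multiplying by [h]
    on the left removes [fund]. *)
Lemma euler_h i j : C (h i j) = 0.
Proof.
have e k : \sum_l fund k l * C (h l j) = 0.
  transitivity (C (\sum_l fund k l * h l j)); last by rewrite fund_h (der_nat CD).
  rewrite (der_sum CD); apply: eq_bigr => l _.
  by rewrite (derM CD) euler_fund mul0r add0r.
transitivity (\sum_l (\sum_k h i k * fund k l) * C (h l j)).
  rewrite (bigD1 i) //= h_fund eqxx mul1r big1 ?addr0 // => l /negbTE ne.
  by rewrite h_fund eq_sym ne mul0r.
under eq_bigr do rewrite mulr_suml.
rewrite exchange_big big1 // => k _ /=.
by under eq_bigr do rewrite -mulrA; rewrite -mulr_sumr e mulr0.
Qed.

Lemma euler_geod i : C (geod i) = 2 * geod i.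
Proof.
rewrite /geod (derM CD) (derM CD) euler_half mul0r mulr0 addr0 mul0r add0r.
rewrite mulrCA; congr (_ * _); rewrite (der_sum CD) mulr_sumr; apply: eq_bigr => l _.
rewrite (derM CD) euler_h mul0r add0r mulrCA; congr (_ * _).
rewrite (derB CD) mulrBr euler_X euler_LL (derM (XD l)) (der_nat (XD l)) mul0r add0r.
congr (_ - _); rewrite (der_sum CD) mulr_sumr; apply: eq_bigr => k _.
rewrite (derM CD) euler_y euler_Y euler_X euler_LL [X k (2 * _)](derM (XD k)) (der_nat (XD
  k)).
rewrite mul0r add0r [Y l (2 * _)](derM (YD l)) (der_nat (YD l)).
by ring.
Qed.

Lemma euler_conn i j : C (conn geod i j) = conn geod i j.
Proof.
by rewrite mxE euler_Y euler_geod (derM (YD j)) (der_nat (YD j)); ring.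
Qed.

Lemma euler_Gam a : C (Gm a) = Gm (C a) + Gm a.
Proof.
rewrite {1}/Gam (derB CD) (derM CD) (der_nat CD) mul0r add0r !(der_sum CD).
under eq_bigr do rewrite (derM CD) euler_y euler_X.
under [X in _ - 2 * X]eq_bigr do rewrite (derM CD) euler_geod euler_Y mulrBr -mulrA.
rewrite !big_split /= -mulr_sumr sumrN /Gam; ring.
Qed.

Lemma euler_jac i k : C (jac geod i k) = 2 * jac geod i k.
Proof.
have jE : jac geod i k =
    2 * X k (geod i) - Gm (conn geod i k) - \sum_j conn geod i j * conn geod j k.
  by rewrite !mxE.
rewrite jE 2!(derB CD) (derM CD) (der_nat CD) mul0r add0r euler_X euler_geod.
rewrite (derM (XD k)) (der_nat (XD k)) mul0r add0r euler_Gam euler_conn.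
have -> : C (\sum_j conn geod i j * conn geod j k) = 2 * \sum_j conn geod i j * conn geod
  j k.
  rewrite (der_sum CD) mulr_sumr; apply: eq_bigr => j _.
  by rewrite (derM CD) !euler_conn; ring.
by ring.
Qed.

(** The trace of the curvature and [L * L] both have degree 2, so their quotient has degree 0. As
    the ring may have zero divisors, cancelling [d] (later n - 1) is a hypothesis, and [L * L] is
    cancelled through [iL]. *)
Lemma euler_scalar (kap d : A) : \tr (jac geod) = d * (kap * (L * L)) ->
  C d = 0 -> (forall a, d * a = 0 -> a = 0) -> C kap = 0.
Proof.
move=> tr d0 dI.
have : C (\tr (jac geod)) = 2 * \tr (jac geod).
  by rewrite /mxtrace (der_sum CD) mulr_sumr; apply: eq_bigr => i _; exact: euler_jac.
rewrite tr (derM CD) d0 mul0r add0r (derM CD) euler_LL => e.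
have : d * (C kap * (L * L)) = 0 by apply: subr_imp_eq e; ring.
move=> /dI e0; rewrite -[C kap]mulr1 -{1}[1](mul1r 1) -{1 2}iLL.
have -> : C kap * (iL * L * (iL * L)) = C kap * (L * L) * (iL * iL) by ring.
by rewrite e0 mul0r.
Qed.

(* The left-hand side of the identity [jac_trace] is computed from the scalar
   curvature condition, the right-hand side from the isotropy of the
   S-curvature [\tr N + \sum_m y m * a m]; the closed form [a] drops out. *)
Lemma scalar_isotropic (kap c : A) (a : 'I_n -> A) :
  (forall i k, jac geod i k = kap * (L * L * (i == k)%:R - y i * mom k)) ->
  \sum_i y i * Y i kap = 0 ->
  (forall i k, Y i (a k) = 0) -> (forall i k, X i (a k) = X k (a i)) ->
  (forall i, Y i c = 0) ->
  \tr N + \sum_m y m * a m = (n.+1)%:R * (c * L) ->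
  forall k, (n.+1)%:R * (Y k kap * (L * L)) =
    (n.+1)%:R * (3 * (X k c * L - (\sum_m y m * X m c) * Y k L)).
Proof.
move=> jE Ekap Ya Xa Yc trN k.
have e := jac_trace geod k.
have Gc : Gm c = \sum_m y m * X m c.
  by rewrite /Gam [X in _ - 2 * X]big1 ?mulr0 ?subr0 // => j _; rewrite Yc mulr0.
have Ga j : Gm (a j) = \sum_m y m * X m (a j).
  by rewrite /Gam [X in _ - 2 * X]big1 ?mulr0 ?subr0 // => i _; rewrite Ya mulr0.
have Ysum : Y k (\sum_m y m * a m) = a k.
  rewrite (der_sum (YD k)) (bigD1 k) //= (derM (YD k)) Yy eqxx Ya mulr0 addr0 mul1r.
  by rewrite big1 ?addr0 // => i /negbTE ne;
    rewrite (derM (YD k)) Yy eq_sym ne Ya mul0r mulr0 addr0.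
(* A closed form contributes nothing to the Euler-Lagrange expression: closedness turns the [X k]
   derivative of its value on [y] into [Gm (a k)], which is [Gm] applied to the [Y k] derivative. *)
have Xsum : X k (\sum_m y m * a m) = Gm (a k).
  by rewrite (der_sum (XD k)) Ga; apply: eq_bigr => m _;
    rewrite (derM (XD k)) Xy mul0r add0r Xa.
have trNE : \tr N = (n.+1)%:R * (c * L) - \sum_m y m * a m by rewrite -trN addrK.
have rhs : X k (\tr N) - Gm (Y k (\tr N)) =
    (n.+1)%:R * (X k c * L - (\sum_m y m * X m c) * Y k L).
  rewrite trNE (derB (XD k)) (derB (YD k)) (derB GD) Ysum Xsum.
  rewrite (derM (XD k)) (derM (YD k)) (der_nat (XD k)) (der_nat (YD k)).
  rewrite (derM (XD k)) (derM (YD k)) Yc !mul0r !add0r !(derM GD) (der_nat GD).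
  by rewrite Gc Gam_YL; ring.
rewrite rhs in e.
have trE : \tr (jac geod) = (n%:R - 1) * (kap * (L * L)).
  rewrite /mxtrace; under eq_bigr do rewrite jE eqxx mulr1 mulrBr.
  rewrite big_split /= sumr_const card_ord sumrN -mulr_sumr y_mom -mulr_natl; ring.
have Ymom i : Y i (mom k) = fund k i by rewrite fundE.
have ySum := y_fund k.
have divE : \sum_m Y m (jac geod m k) =
    Y k (kap * (L * L)) - (n.+1)%:R * (kap * mom k).
  transitivity (\sum_m ((m == k)%:R * Y m (kap * (L * L)) -
     ((y m * Y m kap) * mom k + kap * mom k + kap * (y m * fund k m)))).
    apply: eq_bigr => m _.
    have t1 : Y m (kap * (L * L * (m == k)%:R)) = (m == k)%:R * Y m (kap * (L * L)).
      by rewrite mulrA (derM (YD m)) (der_nat (YD m)) mulr0 addr0 mulrC.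
    rewrite jE mulrBr (derB (YD m)) t1; congr (_ - _).
    rewrite (derM (YD m)) [Y m (y m * _)](derM (YD m)) Yy eqxx.
    by rewrite Ymom mulr1n; ring.
  rewrite big_split sumrN !big_split /=.
  have -> : \sum_m y m * Y m kap * mom k = 0 by rewrite -mulr_suml Ekap mul0r.
  have -> : \sum_m kap * (y m * fund k m) = kap * mom k by rewrite -mulr_sumr ySum.
  rewrite sumr_const card_ord (bigD1 k) //= eqxx big1 => [|i /negbTE ->];
    last by rewrite mul0r.
  by rewrite mulr1n -[kap * _ *+ n]mulr_natl; ring.
rewrite divE trE [Y k ((_ - 1) * _)](derM (YD k)) (derB (YD k)) (der_nat (YD k)) (der1 (YD
  k)) in e.
rewrite (derM (YD k)) in e.
have YLL : Y k (L * L) = 2 * mom k.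
  by rewrite /mom mulrA [2 * half]mulrC h2 mul1r.
(* The coefficient of [kap * mom k] on the left is 4 - 2(n+1) + 2(n-1) = 0. *)
rewrite YLL in e; apply: subr_imp_eq e; ring.
Qed.

End FinslerSpray.
End SprayAlgebra.

(** * Smooth functions on open sets *)

Lemma near_eq_differentiable (R : realType) (V W : normedModType R) (f g : V -> W) (x : V) :
  {near x, f =1 g} -> differentiable f x -> differentiable g x.
Proof.
move=> fg df; have [cf ef] := (diff_locallyP x f).1 df.
have eg : g \o shift x = cst (g x) + 'd f x +o_ (0:V) id.
  apply/eqaddoP => _/posnumP[e].
  move/eqaddoP : ef => /(_ e%:num) /(_ [gt0 of e%:num]).
  apply: filter_app.
  have : \forall h \near (0:V), f (h + x) = g (h + x).
    have := fg; rewrite [X in X -> _](near_shift 0 x) subr0; apply: filter_app.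
    by near=> h.
  apply: filter_app; near=> h => e1.
  have -> : (g \o shift x - (cst (g x) + 'd f x)) h = (f \o shift x - (cst (f x) + 'd f
    x)) h.
    by rewrite /= -![(_ + _ : _ -> _) _]/(_ + _) -![(- _ : _ -> _) _]/(- _) /cst /=
      (nbhs_singleton fg) -e1.
  exact.
apply/(diff_locallyP x g); have -> : ('d g x : V -> W) = 'd f x by exact: diff_unique.
by [].
Unshelve. all: by end_near. Qed.

Section SmoothFunctions.
Variables (R : realType) (V : normedModType R) (U : set V) (oU : open U).
Implicit Types (f g : V -> R) (k : nat).

Lemma open_near x : U x -> \forall z \near x, U z.
Proof. by move=> Ux; apply: open_nbhs_nbhs. Qed.

Lemma derive_ext (W : normedModType R) (f g : V -> W) v x :
  (forall x, U x -> f x = g x) -> U x -> 'D_v f x = 'D_v g x.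
Proof.
by move=> fg Ux; apply: near_eq_derive; apply: filterS (open_near Ux) => z; exact: fg.
Qed.

Lemma Ck_ext (W : normedModType R) k (f g : V -> W) :
  (forall x, U x -> f x = g x) -> Ck k U f -> Ck k U g.
Proof.
elim: k f g => [f g fg cf x Ux|k IH f g fg [df cf]].
  rewrite /prop_for /continuous_at -fg //; apply: cvg_trans (cf x Ux).
  by apply: near_eq_cvg; apply: filterS (open_near Ux) => z; exact: fg.
split=> [x Ux|v].
  apply: near_eq_differentiable (df x Ux).
  by apply: filterS (open_near Ux) => z; exact: fg.
by apply: IH (cf v) => x Ux; exact: derive_ext.
Qed.

Lemma Ck_pred (W : normedModType R) k (f : V -> W) : Ck k.+1 U f -> Ck k U f.
Proof.
elim: k f => [f [df _] x Ux|k IH f [df cf]];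
  first exact: differentiable_continuous (df x Ux).
by split=> // v; apply: IH.
Qed.

Lemma smooth_diff (W : normedModType R) (f : V -> W) x : smooth_on U f -> U x ->
  differentiable f x.
Proof. by move=> /(_ 1%N) [+ _]; apply. Qed.

Lemma smooth_derivable (W : normedModType R) (f : V -> W) x v : smooth_on U f -> U x ->
  derivable f x v.
Proof. by move=> sf Ux; apply: diff_derivable; exact: smooth_diff. Qed.

Lemma smooth_continuous (W : normedModType R) (f : V -> W) x : smooth_on U f -> U x ->
  {for x, continuous f}.
Proof. by move=> /(_ 0%N); apply. Qed.

Lemma smooth_derive (W : normedModType R) (f : V -> W) v : smooth_on U f -> smooth_on U
  ('D_v f).
Proof. by move=> sf k; have [_] := sf k.+1; apply. Qed.

Lemma smooth_ext (W : normedModType R) (f g : V -> W) :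
  (forall x, U x -> f x = g x) -> smooth_on U f -> smooth_on U g.
Proof. by move=> fg sf k; exact: Ck_ext (sf k). Qed.

Lemma Ck_cst (W : normedModType R) k (a : W) : Ck k U (cst a).
Proof.
elim: k a => [a x _|k IH a]; first exact: cst_continuous.
split=> [x Ux|v]; first exact: differentiable_cst.
by apply: (@Ck_ext _ k (cst 0)) => // x _; rewrite derive_cst.
Qed.

Lemma smooth_cst (W : normedModType R) (a : W) : smooth_on U (cst a).
Proof. by move=> k; exact: Ck_cst. Qed.

Lemma CkD k f g : Ck k U f -> Ck k U g -> Ck k U (fun x => f x + g x).
Proof.
elim: k f g => [f g cf cg x Ux|k IH f g [df cf] [dg cg]].
  by apply: continuousD; [exact: cf|exact: cg].
split=> [x Ux|v]; first by apply: differentiableD; [exact: df|exact: dg].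
apply: Ck_ext (IH _ _ (cf v) (cg v)) => x Ux /=.
by rewrite [RHS](@deriveD _ _ _ f g x v) //; apply: diff_derivable; [exact: df|exact: dg].
Qed.

Lemma smoothD f g : smooth_on U f -> smooth_on U g -> smooth_on U (fun x => f x + g x).
Proof. by move=> sf sg k; exact: CkD. Qed.

Lemma CkM k f g : Ck k U f -> Ck k U g -> Ck k U (fun x => f x * g x).
Proof.
elim: k f g => [f g cf cg x Ux|k IH f g sf sg].
  by apply: continuousM; [exact: cf|exact: cg].
have [df cf] := sf; have [dg cg] := sg.
split=> [x Ux|v]; first by apply: differentiableM; [exact: df|exact: dg].
apply: Ck_ext (CkD (IH _ _ (Ck_pred sf) (cg v)) (IH _ _ (Ck_pred sg) (cf v))) => x Ux /=.
by rewrite [RHS](@deriveM _ _ f g x v) //; apply: diff_derivable; [exact: df|exact: dg].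
Qed.

Lemma smoothM f g : smooth_on U f -> smooth_on U g -> smooth_on U (fun x => f x * g x).
Proof. by move=> sf sg k; exact: CkM. Qed.

Lemma CkV k f : (forall x, U x -> f x != 0) -> Ck k U f -> Ck k U (fun x => (f x)^-1).
Proof.
move=> f0; elim: k => [cf x Ux|k IH sf].
  by apply: continuousV; [exact: f0|exact: cf].
have [df cf] := sf.
split=> [x Ux|v]; first by apply: differentiableV; [exact: df|exact: f0].
have i2 := IH (Ck_pred sf).
apply: Ck_ext (CkM (Ck_cst k (-1 : R)) (CkM (CkM i2 i2) (cf v))) => x Ux /=.
rewrite [RHS](@deriveV _ _ f x v) ?f0 //; last by apply: diff_derivable; exact: df.
by rewrite expr2 invfM scaleNr mulN1r.
Qed.

Lemma smoothV f : (forall x, U x -> f x != 0) -> smooth_on U f -> smooth_on U (fun x => (f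
  x)^-1).
Proof. by move=> f0 sf k; exact: CkV. Qed.

End SmoothFunctions.

Lemma derive_affine (R : realType) (V V' W : normedModType R) (l e : V -> V') (f : V' ->
  W) v x :
  (forall h, e (h *: v + x) = h *: l v + e x) -> 'D_v (f \o e) x = 'D_(l v) f (e x).
Proof.
move=> eE; rewrite /derive.
have -> : (fun h => h^-1 *: (((f \o e) \o shift x) (h *: v) - (f \o e) x)) =
    (fun h => h^-1 *: ((f \o shift (e x)) (h *: l v) - f (e x))) => [|//].
by apply/funext => h /=; rewrite eE.
Qed.

Lemma derivable_affine (R : realType) (V V' W : normedModType R) (l e : V -> V') (f : V'
  -> W) v x :
  (forall h, e (h *: v + x) = h *: l v + e x) -> derivable f (e x) (l v) -> derivable (f
    \o e) x v.
Proof.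
move=> eE; rewrite /derivable.
have -> : (fun h => h^-1 *: (((f \o e) \o shift x) (h *: v) - (f \o e) x)) =
    (fun h => h^-1 *: ((f \o shift (e x)) (h *: l v) - f (e x))) => [|//].
by apply/funext => h /=; rewrite eE.
Qed.

(** For an affine map the derivative in direction [v] of the composite is the derivative of [f] in
    the fixed direction [l v]. The iterated definition of [Ck] is therefore preserved without a
    general chain rule. *)
Lemma Ck_affine (R : realType) (V V' W : normedModType R) (l e : V -> V') (U : set V) (U'
  : set V')
    (f : V' -> W) k : open U -> (forall x, U x -> U' (e x)) ->
  (forall x, differentiable e x) ->
  (forall x v h, e (h *: v + x) = h *: l v + e x) -> Ck k U' f -> Ck k U (f \o e).
Proof.
move=> oU eU de le; elim: k f => [f cf x Ux|k IH f [df cf]].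
  apply: continuous_comp; first exact: differentiable_continuous.
  by apply: cf; exact: eU.
split=> [x Ux|v].
  by apply: differentiable_comp; [exact: de|apply: df; exact: eU].
apply: (Ck_ext oU _ (IH _ (cf (l v)))) => x Ux;
  by rewrite (derive_affine _ (fun h => le x v h)).
Qed.

(** * Symmetry of second directional derivatives *)

Section Lines.
Variables (R : realType) (V : normedModType R).

Lemma is_derive_line (f : V -> R) x v (t : R) : derivable f (t *: v + x) v ->
  is_derive t 1 (fun s => f (s *: v + x)) ('D_v f (t *: v + x)).
Proof.
pose e (s : R) := s *: v + x; pose l (s : R) := s *: v.
have eE (h : R) : e (h *: 1 + t) = h *: l 1 + e t.
  by rewrite /e /l scalerDl addrA scale1r /GRing.scale /= mulr1.
move=> d; split; last by rewrite (derive_affine f eE) /l scale1r.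
by apply: (@derivable_affine _ _ _ _ l e f 1 t eE); rewrite /l scale1r.
Qed.

Lemma MVT_line (f : V -> R) x v (s : R) : 0 < s ->
  (forall t, 0 <= t <= s -> derivable f (t *: v + x) v) ->
  exists2 t, 0 < t < s & f (s *: v + x) - f x = s * 'D_v f (t *: v + x).
Proof.
move=> s0 df.
have [||t] := @MVT R (fun t => f (t *: v + x)) (fun t => 'D_v f (t *: v + x)) 0 s s0.
- move=> t /[!in_itv] /= /andP[t0 ts]; apply: is_derive_line.
  by apply: df; rewrite !ltW.
- apply: derivable_within_continuous => t /[!in_itv] /= t0s.
  by have [] := is_derive_line (df _ t0s).
rewrite in_itv /= => t0s; rewrite scale0r add0r subr0 => ->.
by exists t => //; rewrite mulrC.
Qed.

(** The mean value theorem twice: along [u] for the increment of [f] by [s *: v], then along [v] for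
    ['D_u f]. *)
Lemma second_difference (f : V -> R) x u v (s : R) : 0 < s ->
  (forall r t, 0 <= r <= s -> 0 <= t <= s -> let z := t *: v + (r *: u + x) in
    derivable f z u /\ derivable ('D_u f) z v) ->
  exists r t, [/\ 0 < r < s, 0 < t < s &
    f (s *: v + (s *: u + x)) - f (s *: u + x) - (f (s *: v + x) - f x) =
    s * (s * 'D_v ('D_u f) (t *: v + (r *: u + x)))].
Proof.
move=> s0 df; have ss : 0 <= s <= s by apply/andP; split=> //; exact: ltW.
have s0s : 0 <= (0 : R) <= s by apply/andP; split=> //; exact: ltW.
pose F z := f (s *: v + z) - f z.
have dF1 r : 0 <= r <= s -> derivable f (r *: u + x) u.
  by move=> rs; have [] := df r 0 rs s0s; rewrite scale0r add0r.
have eE z (h : R) : s *: v + (h *: u + z) = h *: u + (s *: v + z) by rewrite addrCA.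
have dF2 r : 0 <= r <= s -> derivable (fun z => f (s *: v + z)) (r *: u + x) u.
  move=> rs; apply: (@derivable_affine _ _ _ _ id (fun z => s *: v + z) f u _ (eE _)).
  by have [] := df r s rs ss.
have dF r : 0 <= r <= s -> derivable F (r *: u + x) u.
  by move=> rs; apply: derivableB; [exact: dF2|exact: dF1].
have [r rs e1] := MVT_line s0 dF.
have rs' : 0 <= r <= s by have /andP[? ?] := rs; rewrite !ltW.
have e2 : 'D_u F (r *: u + x) =
    'D_u f (s *: v + (r *: u + x)) - 'D_u f (r *: u + x).
  rewrite (deriveB (dF2 _ rs') (dF1 _ rs')); congr (_ - _).
  exact: (@derive_affine _ _ _ _ id (fun z => s *: v + z) f u _ (eE _)).
have [|t ts e3] := @MVT_line ('D_u f) (r *: u + x) v s s0.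
  by move=> t ts; have [] := df r t rs' ts.
by exists r, t; split => //; rewrite -e3 -e2 -e1.
Qed.

Lemma subrBAC (a b c d : R) : a - b - (c - d) = a - c - (b - d).
Proof. by ring. Qed.

Lemma mulfI_twice (s a b : R) : s != 0 -> s * (s * a) = s * (s * b) -> a = b.
Proof. by move=> s0 /(mulfI s0) /(mulfI s0). Qed.

Lemma continuous_near_lt (g : V -> R) x e : {for x, continuous g} -> 0 < e ->
  \forall z \near x, `|g x - g z| < e.
Proof. by move=> /cvgrPdist_lt; apply. Qed.

(** The second difference over a small parallelogram is symmetric in [u] and [v], and is the square
    of the side times a mixed derivative, taken in either order at points near [x]. The hypotheses
    ask only for directional derivatives, so that the statement applies to the log-volume of the
    indicatrix, whose smoothness is not established beforehand. *)
Lemma schwarz (f : V -> R) (U : set V) x u v : open U -> U x ->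
  (forall z, U z -> [/\ derivable f z u, derivable f z v,
     derivable ('D_u f) z v & derivable ('D_v f) z u]) ->
  {for x, continuous ('D_u ('D_v f))} -> {for x, continuous ('D_v ('D_u f))} ->
  'D_u ('D_v f) x = 'D_v ('D_u f) x.
Proof.
move=> oU Ux df cuv cvu; apply/subr0_eq/eqP; rewrite -normr_le0.
apply/ler_addgt0Pl => e e0; rewrite addr0.
have e20 : 0 < e / 2 by rewrite divr_gt0.
have [d /= d0 dball] : exists2 d : R, 0 < d & forall z, `|x - z| < d ->
  [/\ U z, `|'D_u ('D_v f) x - 'D_u ('D_v f) z| < e / 2 &
    `|'D_v ('D_u f) x - 'D_v ('D_u f) z| < e / 2].
  have : \forall z \near x, [/\ U z, `|'D_u ('D_v f) x - 'D_u ('D_v f) z| < e / 2 &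
    `|'D_v ('D_u f) x - 'D_v ('D_u f) z| < e / 2].
    have n1 := continuous_near_lt cuv e20; have n2 := continuous_near_lt cvu e20.
    apply: filterS3 (open_near oU Ux) n1 n2 => z Uz l1 l2; split;
      [exact: Uz|exact: l1|exact: l2].
  move=> /nbhs_ballP[d /= d0 H]; exists d => // z xz; apply: H.
  by rewrite -ball_normE.
(* The summand 1 keeps [m] positive even when both directions vanish; with [s = d / m] the whole
   parallelogram lies within distance [d] of [x]. *)
pose m := `|u| + `|v| + 1.
have m0 : 0 < m by rewrite ltr_wpDl // addr_ge0.
pose s := d / m.
have s0 : 0 < s by rewrite divr_gt0.
have box a b r t : `|a| + `|b| + 1 = m -> 0 <= r <= s -> 0 <= t <= s ->
    `|x - (t *: b + (r *: a + x))| < d.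
  move=> abm /andP[r0 rs] /andP[t0 ts].
  rewrite addrA opprD addrCA subrr addr0 normrN.
  apply: le_lt_trans (ler_normD _ _) _; rewrite !normrZ !ger0_norm //.
  have -> : d = s * m by rewrite /s mulfVK // gt_eqF.
  rewrite -abm mulrDr mulr1 addrC mulrDr; apply: ltr_pwDr => //.
  by apply: lerD; apply: ler_wpM2r.
have muv : `|v| + `|u| + 1 = m by rewrite /m (addrC `|u|).
have witness a b : (a = u /\ b = v) \/ (a = v /\ b = u) -> exists z A, [/\ `|x - z| < d,
  A = 'D_b ('D_a f) z &
    f (s *: b + (s *: a + x)) - f (s *: a + x) - (f (s *: b + x) - f x) = s * (s * A)].
  move=> ab.
  have abm : `|a| + `|b| + 1 = m by case: ab => -[-> ->] //; rewrite /m (addrC `|u|).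
  have [|r [t [/andP[r0 rs] /andP[t0 ts] e1]]] := @second_difference f x a b s s0.
    move=> r t rs ts z; have [/df[d1 d2 d3 d4] _ _] := dball z (box _ _ _ _ abm rs ts).
    by case: ab => -[-> ->].
  exists (t *: b + (r *: a + x)), ('D_b ('D_a f) (t *: b + (r *: a + x))); split => //.
  by apply: box abm _ _; rewrite !ltW.
have [z [A [xz AE eA]]] := witness u v (or_introl (conj erefl erefl)).
have [z' [B [xz' BE eB]]] := witness v u (or_intror (conj erefl erefl)).
have eAB : A = B.
  have sn0 : s != 0 by rewrite gt_eqF.
  apply: (mulfI_twice sn0); rewrite -eA -eB (addrCA (s *: u)).
  exact: subrBAC.
have [_ _ h1] := dball z xz; have [_ h2 _] := dball z' xz'.
rewrite -AE eAB in h1; rewrite -BE in h2.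
move: h1 h2; generalize ('D_v ('D_u f) x) ('D_u ('D_v f) x) => a b h1 h2.
have -> : b - a = (b - B) - (a - B) by ring.
apply: le_trans (ler_normB _ _) _; rewrite [leRHS](splitr e).
by apply: lerD; exact: ltW.
Qed.

Lemma smooth_schwarz (U : set V) (f : V -> R) x u v : open U -> smooth_on U f -> U x ->
  'D_u ('D_v f) x = 'D_v ('D_u f) x.
Proof.
move=> oU sf Ux; apply: (schwarz oU Ux) => [z Uz||].
- by split; apply: smooth_derivable Uz; do ?apply: smooth_derive.
- by apply: smooth_continuous Ux; do 2 apply: smooth_derive.
- by apply: smooth_continuous Ux; do 2 apply: smooth_derive.
Qed.

End Lines.

(** * The ring of smooth functions on an open set *)

Section SmoothRing.
Variables (R : realType) (V : normedModType R) (U : set V).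

Definition extend0 (f : {z | U z} -> R) (z : V) : R :=
  if pselect (U z) is left Uz then f (exist _ z Uz) else 0.

Lemma extend0E f z (Uz : U z) : extend0 f z = f (exist _ z Uz).
Proof.
rewrite /extend0; case: pselect => // Uz'.
by congr f; congr exist; exact: Prop_irrelevance.
Qed.

Lemma extend0_restrict (f : V -> R) z : U z -> extend0 (fun w => f (sval w)) z = f z.
Proof. by move=> Uz; rewrite extend0E. Qed.

(* Ring elements live on the subtype [{z | U z}], so that they are equal as soon
   as they agree on [U]; the premise [open U] makes this a subring for every [U]. *)
Definition smooth_pred : {pred {z | U z} -> R} :=
  fun f => `[< open U -> smooth_on U (extend0 f) >].

Lemma smooth_pred_subring : subring_closed smooth_pred.
Proof.
split=> [|f g /asboolP sf /asboolP sg|f g /asboolP sf /asboolP sg]; apply/asboolP => oU.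
- by apply: (smooth_ext oU _ (smooth_cst oU (1 : R))) => z Uz; rewrite extend0E.
- apply: (smooth_ext oU _ (smoothD oU (sf oU) (smoothM oU (smooth_cst oU (-1 : R)) (sg
  oU)))).
  by move=> z Uz; rewrite !(extend0E _ Uz) mulN1r.
- apply: (smooth_ext oU _ (smoothM oU (sf oU) (sg oU))).
  by move=> z Uz; rewrite !(extend0E _ Uz).
Qed.

Record smfun := Smfun { smfun_val : {z | U z} -> R; smfun_mem : smfun_val \in smooth_pred }.

HB.instance Definition _ := [isSub for smfun_val].
HB.instance Definition _ := [Choice of smfun by <:].
HB.instance Definition _ := 
  GRing.SubChoice_isSubComPzRing.Build _ _ smfun smooth_pred_subring.

Definition smev (a : smfun) (z : V) : R := extend0 (smfun_val a) z.

Fact mksm_subproof (f : V -> R) : (open U -> smooth_on U f) ->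
  (fun w : {z | U z} => f (sval w)) \in smooth_pred.
Proof.
move=> sf; apply/asboolP => oU.
by apply: (smooth_ext oU _ (sf oU)) => z Uz; rewrite extend0_restrict.
Qed.

Definition mksm (f : V -> R) (sf : open U -> smooth_on U f) : smfun := Smfun
  (mksm_subproof sf).

Lemma smev_mksm f (sf : open U -> smooth_on U f) z : U z -> smev (mksm sf) z = f z.
Proof. exact: extend0_restrict. Qed.

Lemma smev_smooth a : open U -> smooth_on U (smev a).
Proof. by move=> oU; have /asboolP/(_ oU) := smfun_mem a. Qed.

Lemma smfunP (a b : smfun) : (forall z, U z -> smev a z = smev b z) -> a = b.
Proof.
move=> ab; apply: val_inj; apply: funext => -[z Uz] /=.
by have := ab z Uz; rewrite /smev !(extend0E _ Uz).
Qed.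

Lemma smevD a b z : smev (a + b) z = smev a z + smev b z.
Proof. by rewrite /smev /extend0; case: pselect => // _; rewrite addr0. Qed.

Lemma smevM a b z : smev (a * b) z = smev a z * smev b z.
Proof. by rewrite /smev /extend0; case: pselect => // _; rewrite mulr0. Qed.

Lemma smev0 z : smev 0 z = 0.
Proof. by rewrite /smev /extend0; case: pselect. Qed.

Lemma smev1 z : U z -> smev 1 z = 1.
Proof. by move=> Uz; rewrite /smev extend0E. Qed.

Lemma smevN a z : smev (- a) z = - smev a z.
Proof. by apply/eqP; rewrite -addr_eq0 -smevD addNr smev0. Qed.

Lemma smevB a b z : smev (a - b) z = smev a z - smev b z.
Proof. by rewrite smevD smevN. Qed.

Lemma smev_nat k z : U z -> smev k%:R z = k%:R.
Proof.
by move=> Uz; elim: k => [|k IH]; rewrite ?smev0 // !mulrSr smevD IH smev1.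
Qed.

Lemma smev_sum I (r : seq I) (P : pred I) (F : I -> smfun) z :
  smev (\sum_(i <- r | P i) F i) z = \sum_(i <- r | P i) smev (F i) z.
Proof. by apply: (big_morph (smev ^~ z)) => [a b|]; [exact: smevD|exact: smev0]. Qed.

Definition smder (v : V) (a : smfun) : smfun :=
  mksm (fun oU => smooth_derive v (smev_smooth a oU)).

Lemma smev_smder v a z : U z -> smev (smder v a) z = 'D_v (smev a) z.
Proof. by move=> Uz; rewrite smev_mksm. Qed.

Hypothesis oU : open U.

Lemma smder_derivation v : derivation (smder v).
Proof.
split=> a b; apply: smfunP => z Uz.
  rewrite smevD !smev_smder //.
  rewrite -(deriveD (smooth_derivable (smev_smooth a oU) Uz) (smooth_derivable
    (smev_smooth b oU) Uz)).
  by congr ('D_v _ z); apply/funext => w; exact: smevD.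
rewrite smevD !smevM !smev_smder //.
have := deriveM (smooth_derivable (smev_smooth a oU) Uz) (smooth_derivable (smev_smooth b
  oU) Uz).
rewrite /GRing.scale /= addrC [_ * smev b z]mulrC => <-.
by congr ('D_v _ z); apply/funext => w; exact: smevM.
Qed.

Lemma smev_smder2 u v a z : U z -> smev (smder u (smder v a)) z = 'D_u ('D_v (smev a)) z.
Proof.
move=> Uz; rewrite (smev_smder _ _ Uz).
exact: (derive_ext oU u (fun w => @smev_smder v a w) Uz).
Qed.

Lemma smderC u v a : smder u (smder v a) = smder v (smder u a).
Proof.
apply: smfunP => z Uz; rewrite (smev_smder2 u v a Uz) (smev_smder2 v u a Uz).
exact: smooth_schwarz oU (smev_smooth a oU) Uz.
Qed.

End SmoothRing.

(** * Positive definite bilinear forms *)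

Section BilinearForms.
Variables (R : realType) (n : nat).
Implicit Types (g B : 'M[R]_n) (u v w y : 'rV[R]_n).

Definition bform g u v : R := (u *m g *m v^T) 0 0.

Lemma bformE g u v : bform g u v = \sum_i \sum_j g i j * u 0 i * v 0 j.
Proof.
rewrite /bform mxE exchange_big; apply: eq_bigr => j _.
rewrite !mxE mulr_suml; apply: eq_bigr => i _; ring.
Qed.

Lemma bformD g u v w : bform g (u + v) w = bform g u w + bform g v w.
Proof. by rewrite /bform !mulmxDl mxE. Qed.

Lemma bformZ g a u w : bform g (a *: u) w = a * bform g u w.
Proof. by rewrite /bform -!scalemxAl mxE. Qed.

Lemma bformC g u v : g^T = g -> bform g u v = bform g v u.
Proof.
move=> sg; rewrite /bform -[in RHS](trmxK (v *m g *m u^T)) [in RHS]mxE.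
by rewrite !trmx_mul trmxK sg mulmxA.
Qed.

Lemma bformDr g u v w : g^T = g -> bform g w (u + v) = bform g w u + bform g w v.
Proof. by move=> sg; rewrite bformC // bformD !(bformC _ w). Qed.

Lemma bformZr g a u w : g^T = g -> bform g w (a *: u) = a * bform g w u.
Proof. by move=> sg; rewrite bformC // bformZ !(bformC _ w). Qed.

Lemma bform_delta g i j : bform g (delta_mx 0 i) (delta_mx 0 j) = g i j.
Proof. by rewrite /bform -rowE trmx_delta -colE !mxE. Qed.

Lemma bform_eq0 B : B^T = B -> (forall u, bform B u u = 0) -> B = 0.
Proof.
move=> sB B0; apply/matrixP => i j; rewrite mxE.
have := B0 (delta_mx 0 i + delta_mx 0 j).
rewrite bformD !bformDr // !B0 add0r addr0 !bform_delta.
have -> : B j i = B i j by rewrite -{1}sB mxE.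
by move=> e; lra.
Qed.

Definition posdef g := forall u, u != 0 -> 0 < bform g u u.

Lemma posdef_unit g : posdef g -> g \in unitmx.
Proof.
move=> pg; rewrite -row_free_unit -kermx_eq0; apply/rowV0P => u /sub_kermxP ug.
apply/eqP/contraT => /pg; by rewrite /bform ug mul0mx mxE ltxx.
Qed.

(** The determinant of [(1 - t) I + t g] is a polynomial in t equal to 1 at t = 0. It has no zero on
    the unit interval, since these matrices are positive definite and hence invertible, so it is
    still positive at t = 1. *)
Lemma posdef_det g : posdef g -> 0 < \det g.
Proof.
move=> pg.
pose P : 'M[{poly R}]_n := (1 - 'X)%:M + 'X *: map_mx polyC g.
have Pt t : (\det P).[t] = \det ((1 - t)%:M + t *: g).
  rewrite -horner_evalE -det_map_mx; congr (\det _); apply/matrixP => i j.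
  by rewrite !mxE /= horner_evalE hornerD hornerMn hornerM !hornerE.

rewrite ltNge; apply/negP => d0.
have [|t /andP[t0 t1] /rootP] := @poly_ivt _ (- \det P) 0 1 ler01.
  by rewrite !hornerN !Pt subr0 scale0r addr0 det1 subrr scale1r raddf0 add0r oppr_cp0
    ler01 /= oppr_ge0.
rewrite hornerN Pt => /eqP; rewrite oppr_eq0 => /eqP dt.
have : (1 - t)%:M + t *: g \in unitmx.
  apply: posdef_unit => u u0.
  have -> : bform ((1 - t)%:M + t *: g) u u = (1 - t) * (\sum_i u 0 i ^+ 2) + t * bform g
    u u.
    rewrite /bform mulmxDr mulmxDl [LHS]mxE; congr (_ + _); last first.
      by rewrite -scalemxAr -scalemxAl mxE.
    rewrite mul_mx_scalar -scalemxAl mxE; congr (_ * _); rewrite mxE.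
    by apply: eq_bigr => i _; rewrite mxE expr2.
  have s0 : 0 < \sum_i u 0 i ^+ 2.
    have [i ui] : exists i, u 0 i != 0.
      apply/existsP; apply: contraT; rewrite negb_exists => /forallP u00.
      move: u0; apply: contraNT => _; apply/eqP/rowP => i; rewrite mxE.
      by apply/eqP; have := u00 i; rewrite negbK.
    rewrite (bigD1 i) //= ltr_pwDl //; first by rewrite exprn_even_gt0.
    by apply: sumr_ge0 => j _; exact: sqr_ge0.
  have := pg u u0; move: t0 t1; rewrite le_eqVlt => /orP[/eqP <-|t0] t1 q0.
    by rewrite subr0 mul1r mul0r addr0.
  by rewrite ltr_wpDl ?mulr_gt0 // mulr_ge0 ?subr_ge0 // ltW.
by rewrite unitmxE dt unitr0.
Qed.

Lemma free2P y u : y != 0 -> (free [:: y; u] <-> (forall a, u <> a *: y)).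
Proof.
move=> y0; rewrite (perm_free (_ : perm_eq [:: y; u] [:: u; y])); last first.
  by rewrite (perm_catC [:: y] [:: u]).
rewrite free_cons seq1_free y0 andbT span_seq1; split.
  by move=> /negP h a e; apply: h; apply/vlineP; exists a.
by move=> h; apply/negP => /vlineP[a /h].
Qed.

(** The Gram determinant is g(y,y) times the squared g-length of the component of [u] orthogonal to
    [y], and that component is nonzero. *)
Lemma posdef_gram g y u : g^T = g -> posdef g -> y != 0 -> (forall a, u <> a *: y) ->
  0 < bform g y y * bform g u u - bform g y u ^+ 2.
Proof.
move=> sg pg y0 yu; have qy := pg y y0.
pose a := bform g y u / bform g y y.
have w0 : u + (- a) *: y != 0.
  by apply/eqP => e; apply: (yu a); apply/eqP; rewrite -subr_eq0 -scaleNr e.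
have := pg _ w0; rewrite bformD !bformDr // !bformZ !bformZr // (bformC u y) //.
have -> : bform g y u = a * bform g y y by rewrite /a divfK // gt_eqF.
have -> : bform g u u + - a * (a * bform g y y) + (- a * (a * bform g y y) +
  - a * (- a * bform g y y)) = bform g u u - a ^+ 2 * bform g y y by ring.
move=> h; have -> : bform g y y * bform g u u - (a * bform g y y) ^+ 2 =
  bform g y y * (bform g u u - a ^+ 2 * bform g y y) by ring.
exact: mulr_gt0.
Qed.

Lemma exists_indep y : (2 <= n)%N -> y != 0 -> exists u, forall a, u <> a *: y.
Proof.
move=> n2 y0.
have [i yi] : exists i, y 0 i != 0.
  apply/existsP; apply: contraT; rewrite negb_exists => /forallP u00.
  move: y0; apply: contraNT => _; apply/eqP/rowP => i; rewrite mxE.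
  by apply/eqP; have := u00 i; rewrite negbK.
have [j ij] : exists j, j != i.
  have [i0|i0] := eqVneq (val i) 0%N.
    by exists (Ordinal n2); rewrite -val_eqE /= i0.
  have n0 : (0 < n)%N by apply: leq_trans n2.
  by exists (Ordinal n0); rewrite -val_eqE /= eq_sym.
exists (delta_mx 0 j) => a /rowP e.
have := e i; rewrite !mxE eqxx eq_sym (negbTE ij) => /esym/eqP.
rewrite mulf_eq0 (negbTE yi) orbF => /eqP a0.
by have := e j; rewrite !mxE !eqxx a0 mul0r => /eqP; rewrite oner_eq0.
Qed.

(** The flag curvature condition says that the quadratic form of [B] vanishes on all [u] independent
    of [y]. Once it is known to vanish on [y] as well, symmetry gives [B = 0] by polarization, and g
    is inverted. *)
Lemma scalar_curvature_mx g (K : 'M[R]_n) y kap : (2 <= n)%N -> g^T = g ->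
  (g *m K)^T = g *m K -> posdef g -> y != 0 ->
  (forall u, free [:: y; u] -> bform g u (u *m K^T) /
     (bform g y y * bform g u u - bform g y u ^+ 2) = kap) ->
  K = kap *: ((bform g y y)%:M - y^T *m (y *m g)).
Proof.
move=> n2 sg sgK pg y0 Kq.
pose B := g *m K - kap *: (bform g y y *: g - g *m y^T *m (y *m g)).
have sB : B^T = B.
  rewrite /B [LHS]raddfB /= sgK; congr (_ - _); rewrite [LHS]linearZ /=; congr (_ *: _).
  rewrite [LHS]raddfB /= [X in X - _]linearZ /= sg; congr (_ - _).
  by rewrite !trmx_mul trmxK sg.
have BE u : bform B u u = bform g u (u *m K^T) -
    kap * (bform g y y * bform g u u - bform g y u ^+ 2).
  have e : (u *m (g *m y^T *m (y *m g)) *m u^T) 0 0 = bform g y u ^+ 2.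
    rewrite !mulmxA -(mulmxA (u *m g *m y^T)) -(mulmxA (u *m g *m y^T)) mxE big_ord1.
    by rewrite expr2 {2}/bform; congr (_ * _); rewrite -/(bform g u y) bformC.
  rewrite {1}/bform mulmxBr mulmxBl -scalemxAr -scalemxAl mulmxBr mulmxBl.
  rewrite -scalemxAr -scalemxAl /bform trmx_mul trmxK -/(bform g y u).
  by rewrite !mulmxA in e *; rewrite -e !mxE.
have Bind u : (forall a, u <> a *: y) -> bform B u u = 0.
  move=> yu; rewrite BE -(Kq u) ?divfK ?subrr //; last exact/free2P.
  by rewrite gt_eqF // posdef_gram.
have [w yw] := exists_indep n2 y0.
have B0 u : bform B u u = 0.
  have [[a ->]|] := pselect (exists a, u = a *: y); last first.
    by move=> h; apply: Bind => a ua; apply: h; exists a.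
  suff By : bform B y y = 0 by rewrite bformZ bformZr // By !mulr0.
  (* With [w] independent of [y], the form vanishes at y + w, y - w and w; the first two values add
     up to 2 B(y,y) + 2 B(w,w). *)
  have h (s : R) : s != 0 -> bform B (y + s *: w) (y + s *: w) = 0.
    move=> s0; apply: Bind => b e; apply: (yw ((b - 1) / s)).
    by rewrite mulrC -scalerA scalerBl scale1r -e [y + _]addrC addrK scalerA mulVf ?scale1r.
  have h1 := h 1 (oner_neq0 _).
  have h3 := Bind w yw.
  have : -1 != 0 :> R by rewrite oppr_eq0 oner_neq0.
  move=> /h; move: h1; rewrite !bformD !bformDr // !bformZ !bformZr // h3 (bformC w y) //.
  by move=> e1 e2; lra.
have /eqP := bform_eq0 sB B0; rewrite subr_eq0 => /eqP gK.
rewrite -(mulKmx (posdef_unit pg) K) gK -scalemxAr mulmxBr -scalemxAr mulVmx ?posdef_unit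
  //.
by rewrite !mulmxA mulVmx ?posdef_unit // mul1mx scalemx1.
Qed.

End BilinearForms.

(** * Smooth functions of a position and a nonzero direction *)

Section SmoothPairs.
Variables (R : realType) (n : nat) (U : set 'rV[R]_n) (oU : open U).

Definition slit (U : set 'rV[R]_n) := [set z : 'rV[R]_n * 'rV[R]_n | U z.1 /\ z.2 != 0].
Local Notation Om := (slit U).

Lemma open_slit : open Om.
Proof.
have -> : Om = (fst @^-1` U) `&` (snd @^-1` (~` [set 0])).
  by apply/seteqP; split=> z /= [Uz z0]; split=> //; [apply/eqP|apply/eqP/z0].
apply: openI.
  by apply: open_comp => // z _; exact: cvg_fst.
apply: open_comp => [z _|]; first exact: cvg_snd.
apply: closed_openC; exact: (accessible_closed_set1 (hausdorff_accessible (@norm_hausdorff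
  _ _))).
Qed.

Lemma smooth_fst (f : 'rV[R]_n -> R) : smooth_on U f -> smooth_on Om (fun z => f z.1).
Proof.
move=> sf k; apply: (@Ck_affine _ _ _ _ fst fst Om U f k open_slit _ _ _ (sf k)) => [z
  []//|z|//].
by apply: linear_differentiable => w; exact: cvg_fst.
Qed.

Lemma smooth_ycoord i : smooth_on Om (fun z => z.2 0 i).
Proof.
elim => [z _|k _].
  apply: (@continuous_comp _ _ _ snd (fun y : 'rV[R]_n => y 0 i)); first exact: cvg_snd.
  exact: coord_continuous.
split=> [z _|v].
  apply: (@differentiable_comp _ _ _ _ snd (fun y : 'rV[R]_n => y 0 i));
    first by apply: linear_differentiable => w; exact: cvg_snd.
  exact: differentiable_coord.
apply: (Ck_ext open_slit _ (Ck_cst open_slit k (v.2 0 i))) => z _.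
have e (h : R) : (h *: v + z).2 0 i = h *: (v.2 0 i) + z.2 0 i by rewrite !mxE.
pose p (w : 'rV[R]_n * 'rV[R]_n) : R := w.2 0 i.
by have := @derive_affine _ _ _ R p p id v z e; rewrite derive_id => ->.
Qed.

Lemma smooth_slice (f : 'rV[R]_n * 'rV[R]_n -> R) (y : 'rV[R]_n) : y != 0 -> smooth_on Om
  f ->
  smooth_on U (fun x => f (x, y)).
Proof.
move=> y0 sf k.
apply: (@Ck_affine _ _ _ _ (fun v => (v, 0)) (fun x => (x, y)) U Om f k oU _ _ _ (sf k)).
- by move=> x Ux; split.
- move=> x; apply: (@differentiable_pair _ _ _ _ id (cst y) x) => //.
- by move=> x v h; congr pair; rewrite /= scaler0 add0r.
Qed.

(** Dictionary between coordinate expressions, whose values at y = 0 or off [U] are meaningless, and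
    elements of the ring. Agreement on the open slit set is enough for it to pass to [dx] and
    [dy]. *)
Definition rep (f : 'rV[R]_n -> 'rV[R]_n -> R) (a : smfun Om) :=
  forall x y, U x -> y != 0 -> smev a (x, y) = f x y.

Definition smX (i : 'I_n) : smfun Om -> smfun Om := smder (delta_mx 0 i, 0).
Definition smY (i : 'I_n) : smfun Om -> smfun Om := smder (0, delta_mx 0 i).

Lemma rep_dx i f a : rep f a -> rep (dx i f) (smX i a).
Proof.
move=> fa x y Ux y0; rewrite smev_smder; last by split.
rewrite (@derive_ext _ _ _ open_slit _ _ (fun z => f z.1 z.2)).
- have e (h : R) : (h *: delta_mx 0 i + x, y) = h *: (delta_mx 0 i, 0) + (x,
  y) :> 'rV[R]_n * 'rV[R]_n.
    by congr pair; rewrite /= scaler0 add0r.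
  by rewrite -(@derive_affine _ _ _ R (fun v => (v, 0)) (fun x => (x, y)) _ _ _ e).
- by move=> [a1 a2] [/= ? ?]; exact: fa.
- by split.
Qed.

Lemma rep_dy i f a : rep f a -> rep (dy i f) (smY i a).
Proof.
move=> fa x y Ux y0; rewrite smev_smder; last by split.
rewrite (@derive_ext _ _ _ open_slit _ _ (fun z => f z.1 z.2)).
- have e (h : R) : (x, h *: delta_mx 0 i + y) = h *: (0, delta_mx 0 i) + (x,
  y) :> 'rV[R]_n * 'rV[R]_n.
    by congr pair; rewrite /= scaler0 add0r.
  by rewrite -(@derive_affine _ _ _ R (fun v => (0, v)) (fun y => (x, y)) _ _ _ e).
- by move=> [a1 a2] [/= ? ?]; exact: fa.
- by split.
Qed.

Lemma rep_inj f a b : rep f a -> rep f b -> a = b.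
Proof. by move=> fa fb; apply: smfunP => -[x y] [/= Ux y0]; rewrite fa // fb. Qed.

Lemma rep_ext f g a : (forall x y, U x -> y != 0 -> f x y = g x y) -> rep f a -> rep g a.
Proof. by move=> fg fa x y Ux y0; rewrite fa // fg. Qed.

Lemma repD f g a b : rep f a -> rep g b -> rep (fun x y => f x y + g x y) (a + b).
Proof. by move=> fa gb x y Ux y0; rewrite smevD fa // gb. Qed.

Lemma repB f g a b : rep f a -> rep g b -> rep (fun x y => f x y - g x y) (a - b).
Proof. by move=> fa gb x y Ux y0; rewrite smevB fa // gb. Qed.

Lemma repM f g a b : rep f a -> rep g b -> rep (fun x y => f x y * g x y) (a * b).
Proof. by move=> fa gb x y Ux y0; rewrite smevM fa // gb. Qed.

Lemma rep_nat k : rep (fun _ _ => k%:R) k%:R.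
Proof. by move=> x y Ux y0; rewrite smev_nat //; split. Qed.

Lemma rep_sum I (r : seq I) (P : pred I) f a : (forall i, P i -> rep (f i) (a i)) ->
  rep (fun x y => \sum_(i <- r | P i) f i x y) (\sum_(i <- r | P i) a i).
Proof.
by move=> fa x y Ux y0; rewrite smev_sum; apply: eq_bigr => i Pi; exact: fa.
Qed.

Lemma smev_prod I (r : seq I) (P : pred I) (a : I -> smfun Om) z : Om z ->
  smev (\prod_(i <- r | P i) a i) z = \prod_(i <- r | P i) smev (a i) z.
Proof. by move=> Oz; elim/big_rec2: _ => [|i u w _ <-]; [exact: smev1|rewrite smevM]. Qed.

Lemma smev_sign k z : Om z -> smev ((-1) ^+ k : smfun Om) z = (-1) ^+ k.
Proof. by move=> Oz; elim: k => [|k IH]; rewrite ?smev1 // !exprS smevM smevN smev1 // IH.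
  Qed.

Lemma rep_det m (f : 'rV[R]_n -> 'rV[R]_n -> 'M[R]_m) (a : 'M[smfun Om]_m) :
  (forall i j, rep (fun x y => f x y i j) (a i j)) -> rep (fun x y => \det (f x y)) (\det
    a).
Proof.
move=> fa x y Ux y0; rewrite /determinant smev_sum; apply: eq_bigr => s _.
rewrite smevM smev_sign ?smev_prod //; congr (_ * _); apply: eq_bigr => i _.
exact: fa.
Qed.

Lemma rep_adj m (f : 'rV[R]_n -> 'rV[R]_n -> 'M[R]_m) (a : 'M[smfun Om]_m) i j :
  (forall i j, rep (fun x y => f x y i j) (a i j)) ->
  rep (fun x y => \adj (f x y) i j) (\adj a i j).
Proof.
move=> fa; rewrite mxE /cofactor => x y Ux y0; rewrite !mxE smevM smev_sign //;
  congr (_ * _).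
apply: (@rep_det _ (fun x y => row' j (col' i (f x y)))) => // k l x' y' Ux' y0'.
by rewrite !mxE; exact: fa.
Qed.

End SmoothPairs.

(** * Finsler metrics in a chart *)

(** The segment joining two independent vectors avoids 0, so the mean value theorem applies along
    it. Dependent vectors are joined through a third one, which exists because n is at least 2. *)
Lemma punctured_const (R : realType) n (f : 'rV[R]_n -> R) : (2 <= n)%N ->
  (forall z v, z != 0 -> is_derive z v f 0) ->
  forall y1 y2, y1 != 0 -> y2 != 0 -> f y1 = f y2.
Proof.
move=> n2 df; have seg (u w : 'rV[R]_n) : u != 0 -> (forall b, w <> b *: u) -> f u = f w.
  move=> u0 uw.
  have nz t : t *: (w - u) + u != 0.
    apply/eqP => e; have [t0|t0] := eqVneq t 0.
      by move: e u0; rewrite t0 scale0r add0r => ->; rewrite eqxx.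
    apply: (uw ((t - 1) / t)); rewrite mulrC -scalerA scalerBl scale1r.
    have -> : t *: u - u = t *: w.
      by apply/esym/subr0_eq; rewrite -[RHS]e scalerBr opprB addrA addrAC.
    by rewrite scalerA mulVf // scale1r.
  have [|t _] := @MVT_line R _ f u (w - u) 1 ltr01.
    by move=> t _; have [] := df _ (w - u) (nz t).
  have [_ ->] := df _ (w - u) (nz t); rewrite mulr0 scale1r subrK.
  by move=> /subr0_eq.
move=> y1 y2 y10 y20.
have [[b yb]|] := pselect (exists b, y2 = b *: y1); last first.
  by move=> h; apply: seg => // b yb; apply: h; exists b.
have [u yu] := exists_indep n2 y10.
rewrite (seg y1 u y10 yu); apply/esym/seg => // d ud; apply: (yu (d * b)).
by rewrite ud yb scalerA.
Qed.

Section LocalFinsler.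
Variables (R : realType) (n : nat) (U : set 'rV[R]_n) (oU : open U).
Variable L : 'rV[R]_n -> 'rV[R]_n -> R.
Hypothesis L_smooth : smooth_on (slit U) (fun z => L z.1 z.2).
Hypothesis L_homog : forall x y t, U x -> 0 < t -> L x (t *: y) = t * L x y.
Hypothesis L_ge0 : forall x y, U x -> 0 <= L x y.
Hypothesis L_posdef : forall x y u, U x -> y != 0 -> u != 0 -> 0 < ginner L x y u u.

Local Notation Om := (slit U).
Local Notation A := (smfun Om).
Local Notation X := (@smX R n U).
Local Notation Y := (@smY R n U).

Definition smcst (r : R) : A := mksm (fun oO => smooth_cst oO r).
Definition smcoord (i : 'I_n) : A := mksm (fun=> smooth_ycoord oU i).
Definition smL : A := mksm (fun=> L_smooth).
Definition smhalf : A := smcst 2^-1.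
Local Notation y_ := smcoord.

Lemma rep_cst r : rep (fun _ _ => r) (smcst r).
Proof. by move=> x y Ux y0; rewrite smev_mksm //; split. Qed.

Lemma rep_coord i : rep (fun _ y => y 0 i) (y_ i).
Proof. by move=> x y Ux y0; rewrite smev_mksm //; split. Qed.

Lemma rep_L : rep L smL.
Proof. by move=> x y Ux y0; rewrite smev_mksm //; split. Qed.

Lemma smXD i : derivation (X i). Proof. exact: smder_derivation (open_slit oU) _. Qed.
Lemma smYD i : derivation (Y i). Proof. exact: smder_derivation (open_slit oU) _. Qed.
Lemma smXX i j a : X i (X j a) = X j (X i a). Proof. exact: smderC (open_slit oU) _ _ _.
  Qed.
Lemma smXY i j a : X i (Y j a) = Y j (X i a). Proof. exact: smderC (open_slit oU) _ _ _.
  Qed.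
Lemma smYY i j a : Y i (Y j a) = Y j (Y i a). Proof. exact: smderC (open_slit oU) _ _ _.
  Qed.

Lemma dx_indep_x i (f : 'rV[R]_n -> R) x y : dx i (fun _ => f) x y = 0.
Proof. by rewrite /dx /partial derive_cst. Qed.

Lemma smX_indep_x i f a : @rep R n U (fun _ => f) a -> X i a = 0.
Proof.
move=> fa; apply: (rep_inj (rep_dx oU i fa)) => x y Ux y0.
by rewrite smev0 dx_indep_x.
Qed.

Lemma smY_indep_y i (f : 'rV[R]_n -> R) a : @rep R n U (fun x _ => f x) a -> Y i a = 0.
Proof.
move=> fa; apply: (rep_inj (rep_dy oU i fa)) => x y Ux y0.
by rewrite smev0 /dy /partial derive_cst.
Qed.

Lemma smXy i j : X i (y_ j) = 0.
Proof. exact: smX_indep_x (rep_coord j). Qed.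

Lemma derive_coord m (v y : 'rV[R]_m) j : 'D_v (fun y : 'rV[R]_m => y 0 j) y = v 0 j.
Proof.
have e (h : R) : (h *: v + y) 0 j = h *: (v 0 j) + y 0 j by rewrite !mxE.
pose p (w : 'rV[R]_m) : R := w 0 j.
by have := @derive_affine _ _ _ R p p id v y e; rewrite derive_id => ->.
Qed.

Lemma smYy i j : Y i (y_ j) = (i == j)%:R.
Proof.
apply: (rep_inj (rep_dy oU i (rep_coord j))) => x y Ux y0.
by rewrite smev_nat /dy /partial ?derive_coord ?mxE ?eqxx 1?eq_sym //; split.
Qed.

Lemma smh2 : smhalf * 2 = 1.
Proof.
have := repM (rep_cst 2^-1) (@rep_nat R n U 2) => e.
apply: (rep_inj e) => x y Ux y0.
by rewrite smev1 ?mulVf //; split.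
Qed.

(** Euler's theorem: both sides of L(x, (1+s) y) = (1+s) L(x, y), valid for s > -1, are
    differentiated at s = 0. *)
Lemma euler_L : \sum_i y_ i * Y i smL = smL.
Proof.
have e : rep (fun x y => \sum_i y 0 i * dy i L x y) (\sum_i y_ i * Y i smL).
  by apply: rep_sum => i _; apply: repM; [exact: rep_coord|exact: rep_dy rep_L].
apply: (rep_inj e) => x y Ux y0; rewrite rep_L //.
have Oxy : Om (x, y) by split.
have dL : differentiable (fun z => L z.1 z.2) (x, y) := smooth_diff L_smooth Oxy.
have -> : \sum_i y 0 i * dy i L x y = 'D_(0, y) (fun z => L z.1 z.2) (x, y).
  rewrite deriveE //.
  have -> : ((0, y) : 'rV[R]_n * 'rV[R]_n) = \sum_i y 0 i *: (0, delta_mx 0 i).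
    rewrite [RHS]surjective_pairing (raddf_sum fst) (raddf_sum snd) /=; congr pair.
      by rewrite big1 // => i _ /=; rewrite scaler0.
    by rewrite [LHS]row_sum_delta.
  rewrite linear_sum; apply: eq_bigr => i _; rewrite linearZ /= -deriveE //.
  congr (_ * _); rewrite /dy /partial.
  have e1 (h : R) : (x, h *: delta_mx 0 i + y) = h *: (0, delta_mx 0 i) + (x,
    y) :> 'rV[R]_n * 'rV[R]_n.
    by congr pair; rewrite /= scaler0 add0r.
  by rewrite -(@derive_affine _ _ _ R (fun v => (0, v)) (fun y => (x, y)) _ _ _ e1).
have d0 : derivable (fun z => L z.1 z.2) (0 *: (0, y) + (x, y)) (0, y).
  by rewrite scale0r add0r; exact: diff_derivable.
have := is_derive_line d0; rewrite scale0r add0r => d1.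
have d2 : is_derive (0 : R) 1 (fun s => (1 + s) * L x y) (L x y).
  by apply: is_derive_eq; rewrite addr0 add0r /GRing.scale /= mulr0 mulr1 add0r.
have near1 : \forall s \near (0 : R), (1 + s) * L x y = L (s *: (0, y) + (x,
  y)).1 (s *: (0, y) + (x, y)).2.
  have : \forall s \near (0 : R), -1 < s by apply: lt_nbhsr; rewrite oppr_lt0.
  apply: filterS => s s1 /=.
  rewrite scaler0 add0r -[in RHS](scale1r y) scalerA mulr1 -scalerDl L_homog //.
    by rewrite addrC.
  by lra.
have d3 := near_eq_is_derive near1 d2.
by case: d1 => _ <-; case: d3 => _ <-.
Qed.

Local Notation gA := (fund Y smhalf smL).
Local Notation pA := (mom Y smhalf smL).

Lemma rep_sqF : rep (sqF L) (smL * smL).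
Proof. by apply: (rep_ext _ (repM rep_L rep_L)) => x y _ _; rewrite /sqF expr2. Qed.

Lemma rep_gmx i j : rep (fun x y => gmx L x y i j) (gA i j).
Proof.
rewrite mxE; apply: (rep_ext _ (repM (rep_cst _) (rep_dy oU j (rep_dy oU i rep_sqF)))).
by move=> x y _ _; rewrite mxE.
Qed.

Lemma gmx_sym x y : U x -> y != 0 -> (gmx L x y)^T = gmx L x y.
Proof.
move=> Ux y0; apply/matrixP => i j; rewrite mxE -!(rep_gmx _ _ Ux y0).
by rewrite (fundC smYY).
Qed.

Lemma gmx_posdef x y : U x -> y != 0 -> posdef (gmx L x y).
Proof. by move=> Ux y0 u u0; rewrite bformE; exact: L_posdef. Qed.

Lemma gmx_yy x y : U x -> y != 0 -> bform (gmx L x y) y y = L x y ^+ 2.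
Proof.
move=> Ux y0; rewrite bformE.
have h := y_mom smYD smh2 euler_L.
rewrite -/(sqF L x y) -(rep_sqF Ux y0) -h smev_sum; apply: eq_bigr => i _.
rewrite -(y_fund smYD smYY smYy smh2 euler_L) smevM (rep_coord _ Ux y0) smev_sum mulr_sumr.
apply: eq_bigr => j _.
by rewrite smevM (rep_coord _ Ux y0) (rep_gmx _ _ Ux y0); ring.
Qed.

(** A Finsler metric is only required to be nonnegative; strict positivity comes from g_y(y,y) = F^2
    and positive definiteness. *)
Lemma metric_gt0 x y : U x -> y != 0 -> 0 < L x y.
Proof.
move=> Ux y0; rewrite lt_def L_ge0 // andbT.
have := gmx_posdef Ux y0 y0; rewrite gmx_yy //.
by apply: contraTneq => ->; rewrite expr0n ltxx.
Qed.

Fact smiL_subproof : smooth_on Om (fun z => (L z.1 z.2)^-1).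
Proof.
apply: smoothV L_smooth => [|[x y] [/= Ux y0]]; first exact: open_slit.
by rewrite gt_eqF // metric_gt0.
Qed.
Definition smiL : A := mksm (fun=> smiL_subproof).

Lemma rep_iL : rep (fun x y => (L x y)^-1) smiL.
Proof. by move=> x y Ux y0; rewrite smev_mksm //; split. Qed.

Lemma smiLL : smiL * smL = 1.
Proof.
apply: (rep_inj (repM rep_iL rep_L)) => x y Ux y0.
by rewrite mulVf ?smev1 // gt_eqF // metric_gt0.
Qed.

Lemma rep_detg : rep (fun x y => \det (gmx L x y)) (\det gA).
Proof. by apply: rep_det => i j; exact: rep_gmx. Qed.

Lemma det_gmx_gt0 x y : U x -> y != 0 -> 0 < \det (gmx L x y).
Proof. by move=> Ux y0; apply: posdef_det; exact: gmx_posdef. Qed.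

Fact smidet_subproof : smooth_on Om (fun z => (\det (gmx L z.1 z.2))^-1).
Proof.
apply: smoothV => [|[x y] [/= Ux y0]|]; first exact: open_slit.
  by rewrite gt_eqF // det_gmx_gt0.
apply: smooth_ext (smev_smooth (\det gA) (open_slit oU)); first exact: open_slit.
by move=> [x y] [/= Ux y0]; exact: rep_detg.
Qed.
Definition smidet : A := mksm (fun=> smidet_subproof).

(** Cramer's rule: the adjugate is polynomial in the entries, so the inverse of the determinant is
    the only new smooth function that the inverse metric requires. *)
Definition smh (i j : 'I_n) : A := smidet * (\adj gA) i j.

Lemma rep_idet : rep (fun x y => (\det (gmx L x y))^-1) smidet.
Proof. by move=> x y Ux y0; rewrite smev_mksm //; split. Qed.

Lemma rep_h i j : rep (fun x y => invmx (gmx L x y) i j) (smh i j).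
Proof.
apply: (rep_ext _ (repM rep_idet (rep_adj i j rep_gmx))) => x y Ux y0.
by rewrite /invmx posdef_unit ?mxE //; exact: gmx_posdef.
Qed.

Lemma smfund_h i j : \sum_k gA i k * smh k j = (i == j)%:R.
Proof.
have e : smidet * \det gA = 1.
  apply: (rep_inj (repM rep_idet rep_detg)) => x y Ux y0.
  by rewrite mulVf ?smev1 // gt_eqF // det_gmx_gt0.
transitivity (smidet * (gA *m \adj gA) i j).
  by rewrite [in RHS]mxE mulr_sumr; apply: eq_bigr => k _; rewrite /smh; ring.
by rewrite mul_mx_adj [X in _ * X]mxE mulrnAr e.
Qed.

Local Notation G := (geod X Y y_ smhalf smL smh).
Local Notation N := (conn Y G).
Local Notation J := (jac X Y y_ G).

Lemma rep_spray i : rep (spray L i) (G i).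
Proof.
have e : rep (fun x y => 2^-1 * 2^-1 * \sum_l invmx (gmx L x y) i l *
   (\sum_k dy l (dx k (sqF L)) x y * y 0 k - dx l (sqF L) x y)) (G i).
  apply: repM; first by apply: repM; exact: rep_cst.
  apply: rep_sum => l _; apply: repM; first exact: rep_h.
  apply: repB; last by apply: rep_dx => //; exact: rep_sqF.
  apply: rep_sum => k _; apply: repM; last exact: rep_coord.
  by apply: rep_dy => //; apply: rep_dx => //; exact: rep_sqF.
apply: rep_ext e => x y _ _; rewrite /spray; congr (_ * _).
by rewrite -invfM; congr (_^-1); ring.
Qed.

Lemma rep_conn i j : rep (dy j (spray L i)) (N i j).
Proof. by rewrite mxE; apply: rep_dy => //; exact: rep_spray. Qed.

Lemma rep_riemann i k : rep (riemann L i k) (J i k).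
Proof.
have jE : J i k = 2 * X k (G i) - (\sum_j y_ j * X j (N i k) - 2 * \sum_j G j * Y j (N i
  k)) -
   \sum_j N i j * N j k by rewrite !mxE.
have e : rep (fun x y => 2 * dx k (spray L i) x y -
    (\sum_j y 0 j * dx j (dy k (spray L i)) x y
      - 2 * \sum_j spray L j x y * dy j (dy k (spray L i)) x y)
    - \sum_j dy j (spray L i) x y * dy k (spray L j) x y) (J i k).
  rewrite jE; apply: repB; last by apply: rep_sum => j _; apply: repM; exact: rep_conn.
  apply: repB.
    by apply: repM; [exact: rep_nat|apply: rep_dx => //; exact: rep_spray].
  apply: repB.
    by apply: rep_sum => j _; apply: repM; [exact: rep_coord|apply: rep_dx => //;
      exact: rep_conn].
  apply: repM; first exact: rep_nat.
  by apply: rep_sum => j _; apply: repM; [exact: rep_spray|apply: rep_dy => //;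
    exact: rep_conn].
apply: rep_ext e => x y _ _; rewrite /riemann.
have r (a b c d : R) : a - (b - c) - d = a - b + c - d by ring.
exact: r.
Qed.

(** * Scalar flag curvature and the vanishing y-gradient *)

Section Rigidity.
Variables (kap : 'rV[R]_n -> 'rV[R]_n -> R).
Hypothesis n2 : (2 <= n)%N.
Hypothesis flag : forall x y u, U x -> free [:: y; u] -> flag_curvature L x y u = kap x y.

Lemma riemann_scalar x y i k : U x -> y != 0 ->
  riemann L i k x y = kap x y * (L x y ^+ 2 * (i == k)%:R - y 0 i * \sum_j y 0 j * gmx L x
    y k j).
Proof.
move=> Ux y0; pose K := \matrix_(i, k) riemann L i k x y.
have sg := gmx_sym Ux y0.
have KE : K = kap x y *: ((bform (gmx L x y) y y)%:M - y^T *m (y *m gmx L x y)).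
  apply: scalar_curvature_mx => //; [|exact: gmx_posdef|]; last first.
    move=> u yu; rewrite -(flag Ux yu) /flag_curvature /ginner -!bformE.
    congr (bform _ _ _ / _); apply/rowP => j; rewrite !mxE.
    by apply: eq_bigr => l _; rewrite !mxE mulrC.
  apply/matrixP => a b; rewrite mxE.
  have sE c d : (gmx L x y *m K) c d = smev ((gA *m J) c d) (x, y).
    rewrite mxE [in RHS]mxE smev_sum; apply: eq_bigr => l _.
    by rewrite smevM (rep_gmx _ _ Ux y0) (rep_riemann _ _ Ux y0) [K l d]mxE.
  rewrite !sE (fund_jac_sym smXD smYD smXX smXY smYY smXy smYy smh2) //.
  exact: smfund_h.
have := congr1 (fun P : 'M[R]_n => P i k) KE; rewrite mxE => ->.
rewrite gmx_yy // mxE; congr (_ * _); rewrite [LHS]mxE; congr (_ + _).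
  by rewrite mxE mulr_natr.
rewrite mxE; congr (- _); rewrite mxE big_ord1 mxE; congr (_ * _).
by rewrite mxE; apply: eq_bigr => j _; rewrite -{1}sg [in LHS]mxE.
Qed.

Lemma rep_mom k : rep (fun x y => \sum_j y 0 j * gmx L x y k j) (pA k).
Proof.
rewrite -(y_fund smYD smYY smYy smh2 euler_L).
by apply: rep_sum => j _; apply: repM; [exact: rep_coord|exact: rep_gmx].
Qed.

(** [kap] comes as a bare function. Its smoothness is obtained from the trace of the Riemann
    curvature, which equals (n - 1) [kap] F^2. *)
Definition smkap : A := smcst (n.-1)%:R^-1 * (smiL * smiL) * \tr J.

Lemma predn_neq0 : (n.-1)%:R != 0 :> R.
Proof. by rewrite pnatr_eq0; case: (n) n2 => [|[]]. Qed.

Lemma natr_pred : (n.-1)%:R = n%:R - 1 :> R.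
Proof. by rewrite -[in RHS](@prednK n) ?(ltn_trans _ n2) // -natr1 addrK. Qed.

Lemma trace_riemann x y : U x -> y != 0 ->
  \sum_i riemann L i i x y = (n.-1)%:R * (kap x y * (L x y * L x y)).
Proof.
move=> Ux y0; under eq_bigr do rewrite riemann_scalar // eqxx mulr1.
rewrite -mulr_sumr big_split /= sumr_const card_ord sumrN natr_pred.
have -> : \sum_i y 0 i * (\sum_j y 0 j * gmx L x y i j) = L x y ^+ 2.
  rewrite -gmx_yy // bformE; apply: eq_bigr => i _; rewrite mulr_sumr.
  by apply: eq_bigr => j _; ring.
by rewrite -mulr_natl; ring.
Qed.

Lemma rep_kap : rep kap smkap.
Proof.
have e : rep (fun x y => (n.-1)%:R^-1 * ((L x y)^-1 * (L x y)^-1) * \sum_i riemann L i i x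
  y) smkap.
  apply: repM; first by apply: repM; [exact: rep_cst|apply: repM; exact: rep_iL].
  by apply: rep_sum => i _; exact: rep_riemann.
apply: rep_ext e => x y Ux y0; rewrite trace_riemann //.
have := metric_gt0 Ux y0; have := predn_neq0; move: (_%:R) (L x y) => m l m0 l0.
by field; rewrite m0 gt_eqF.
Qed.

Lemma jac_scalar i k : J i k = smkap * (smL * smL * (i == k)%:R - y_ i * pA k).
Proof.
apply: (rep_inj (rep_riemann i k)) => x y Ux y0; rewrite riemann_scalar //.
rewrite (smevM smkap) (rep_kap Ux y0) smevB (smevM (smL * _)) (smevM smL) (smevM (y_ i)).
rewrite (rep_L Ux y0) (rep_mom _ Ux y0) (rep_coord _ Ux y0) smev_nat ?expr2 //.
Qed.

Lemma natr_inj_smfun m (a : A) : (0 < m)%N -> m%:R * a = 0 -> a = 0.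
Proof.
move=> m0 e; have em : smcst m%:R^-1 * m%:R = 1.
  apply: (rep_inj (repM (rep_cst _) (@rep_nat R n U m))) => x y Ux y0.
  by rewrite smev1 ?mulVf // pnatr_eq0 -lt0n.
by rewrite -[a]mul1r -em -mulrA e mulr0.
Qed.

Lemma euler_kap : \sum_i y_ i * Y i smkap = 0.
Proof.
rewrite -/(euler Y y_ smkap).
apply: (euler_scalar smXD smYD smXY smYY smXy smYy smh2 smfund_h euler_L smiLL (d :=
  (n.-1)%:R)).
- apply: (@rep_inj R n U (fun x y => \sum_i riemann L i i x y)).
    by apply: rep_sum => i _; exact: rep_riemann.
  move=> x y Ux y0; rewrite trace_riemann //.
  rewrite (smevM _%:R) (smevM smkap) (smevM smL) smev_nat; last by split.
  by rewrite (rep_kap Ux y0) (rep_L Ux y0).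
- by rewrite (der_nat (euler_derivation smYD y_)).
- move=> a; apply: natr_inj_smfun.
  by case: (n) n2 => [|[]].
Qed.

Variables (c : 'rV[R]_n -> R) (a : 'I_n -> 'rV[R]_n -> R).
Hypothesis c_smooth : smooth_on U c.
Hypothesis a_smooth : forall i, smooth_on U (a i).
Hypothesis a_closed : forall i k x, U x -> partial i (a k) x = partial k (a i) x.
Hypothesis S_iso : forall x y, U x -> y != 0 ->
  \sum_m dy m (spray L m) x y + \sum_m y 0 m * a m x = (n.+1)%:R * (c x * L x y).

Definition smc : A := mksm (fun=> smooth_fst oU c_smooth).
Definition sma i : A := mksm (fun=> smooth_fst oU (a_smooth i)).

Lemma rep_c : rep (fun x _ => c x) smc.
Proof. by move=> x y Ux y0; rewrite smev_mksm //; split. Qed.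

Lemma rep_a i : rep (fun x _ => a i x) (sma i).
Proof. by move=> x y Ux y0; rewrite smev_mksm //; split. Qed.

(** The future sigma in this chart, still formally a function of (x, y). *)
Definition smW : A := smkap - 3 * (\sum_m y_ m * X m smc) * smiL.

Lemma Y_smW k : Y k smW = 0.
Proof.
have Yc i : Y i smc = 0 by exact: smY_indep_y rep_c.
have e : (n.+1)%:R * (Y k smkap * (smL * smL)) =
    (n.+1)%:R * (3 * (X k smc * smL - (\sum_m y_ m * X m smc) * Y k smL)).
  apply: (scalar_isotropic smXD smYD smXY smYY smXy smYy smh2 smfund_h euler_L smiLL
    jac_scalar euler_kap (a := sma)) => //.
  - by move=> i j; exact: smY_indep_y (rep_a j).
  - move=> i j; apply: (rep_inj (rep_dx oU i (rep_a j))) => x y Ux y0.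
    rewrite (rep_dx oU j (rep_a i) Ux y0) /dx; exact: a_closed.
  - apply: (@rep_inj R n U (fun x y => \sum_m dy m (spray L m) x y + \sum_m y 0 m * a m x)).
      apply: repD; first by apply: rep_sum => m _; exact: rep_conn.
      by apply: rep_sum => m _; apply: repM; [exact: rep_coord|exact: rep_a].
    move=> x y Ux y0; rewrite S_iso // !smevM smev_nat; last by split.
    by rewrite (rep_c Ux y0) (rep_L Ux y0).
have {}e : Y k smkap * (smL * smL) = 3 * (X k smc * smL - (\sum_m y_ m * X m smc) * Y k
  smL).
  by apply/subr0_eq; apply: (@natr_inj_smfun n.+1) => //; rewrite mulrBr e subrr.
have Ysum : Y k (\sum_m y_ m * X m smc) = X k smc.
  rewrite (der_sum (smYD k)) (bigD1 k) //= big1 ?addr0 => [|i /negbTE ne].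
    by rewrite (derM (smYD k)) smYy eqxx -smXY Yc (der0 (smXD k)) mulr0 addr0 mul1r.
  by rewrite (derM (smYD k)) smYy eq_sym ne -smXY Yc (der0 (smXD i)) mulr0 addr0 mul0r.
have YiL : Y k smiL = - (smiL * smiL * Y k smL).
  have : Y k (smiL * smL) = 0 by rewrite smiLL (der1 (smYD k)).
  rewrite (derM (smYD k)) => e0.
  transitivity ((Y k smiL * smL + smiL * Y k smL) * smiL - smiL * smiL * Y k smL);
    last by rewrite e0 mul0r sub0r.
  by rewrite mulrDl -mulrA (mulrC smL) smiLL; ring.
have Ykap : Y k smkap = Y k smkap * (smL * smL) * (smiL * smiL).
  transitivity (Y k smkap * ((smiL * smL) * (smiL * smL))); last by ring.
  by rewrite smiLL !mulr1.
rewrite /smW (derB (smYD k)) [Y k (3 * _ * smiL)](derM (smYD k)) [Y k (3 * _)](derM (smYD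
  k)) (der_nat (smYD k)) Ysum YiL Ykap e.
transitivity (3 * X k smc * smiL * (smiL * smL - 1)); first by ring.
by rewrite smiLL subrr mulr0.
Qed.

Lemma smW_const x (y1 y2 : 'rV[R]_n) : U x -> y1 != 0 -> y2 != 0 ->
  smev smW (x, y1) = smev smW (x, y2).
Proof.
move=> Ux; apply: (punctured_const n2 (f := fun y => smev smW (x, y))) => z v z0.
have Oxz : Om (x, z) by split.
have dW : differentiable (smev smW) (x, z) := smooth_diff (smev_smooth smW (open_slit oU))
  Oxz.
have e1 (w : 'rV[R]_n) (h : R) : (x, h *: w + z) = h *: (0, w) + (x,
  z) :> 'rV[R]_n * 'rV[R]_n.
  by congr pair; rewrite /= scaler0 add0r.
split.
  apply: (@derivable_affine _ _ _ R (fun v => (0, v)) (fun y => (x, y)) _ _ _ (e1 v)).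
  exact: diff_derivable.
have -> : 'D_v (fun y => smev smW (x, y)) z = 'D_(0, v) (smev smW) (x, z).
  by rewrite -(@derive_affine _ _ _ R (fun v => (0, v)) (fun y => (x, y)) _ _ _ (e1 v)).
rewrite deriveE //.
have -> : ((0, v) : 'rV[R]_n * 'rV[R]_n) = \sum_i v 0 i *: (0, delta_mx 0 i).
  rewrite [RHS]surjective_pairing (raddf_sum fst) (raddf_sum snd) /=; congr pair.
    by rewrite big1 // => i _ /=; rewrite scaler0.
  by rewrite [LHS]row_sum_delta.
rewrite linear_sum big1 // => i _; rewrite linearZ /= -deriveE //.
have := congr1 (fun w : A => smev w (x, z)) (Y_smW i).
by rewrite smev0 (smev_smder _ _ Oxz) => ->; rewrite scaler0.
Qed.

Lemma rep_smW :
  rep (fun x y => kap x y - 3 * ((\sum_m partial m c x * y 0 m) / L x y)) smW.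
Proof.
have e : rep (fun x y => kap x y - 3 * (\sum_m y 0 m * dx m (fun x _ => c x) x y) * (L x
  y)^-1) smW.
  apply: repB; first exact: rep_kap.
  apply: repM; last exact: rep_iL.
  apply: repM; first exact: rep_nat.
  by apply: rep_sum => m _; apply: repM; [exact: rep_coord|apply: rep_dx => //;
    exact: rep_c].
apply: rep_ext e => x y _ _; rewrite -mulrA; congr (_ - _ * (_ / _)).
by apply: eq_bigr => m _; rewrite mulrC.
Qed.

Lemma local_rigidity x (y1 y2 : 'rV[R]_n) : U x -> y1 != 0 -> y2 != 0 ->
  kap x y1 - 3 * ((\sum_m partial m c x * y1 0 m) / L x y1) =
  kap x y2 - 3 * ((\sum_m partial m c x * y2 0 m) / L x y2).
Proof.
move=> Ux y10 y20; have := smW_const Ux y10 y20; rewrite !rep_smW //.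
Qed.

Lemma local_sigma_smooth (y : 'rV[R]_n) : y != 0 ->
  smooth_on U (fun x => kap x y - 3 * ((\sum_m partial m c x * y 0 m) / L x y)).
Proof.
move=> y0.
apply: (smooth_ext oU _ (smooth_slice oU y0 (smev_smooth smW (open_slit oU)))) => x Ux.
by rewrite rep_smW.
Qed.

End Rigidity.

End LocalFinsler.

(** * Volume *)

Section Volume.
Variable R : realType.
Local Notation mu := (@lebesgue_measure R).

(* Induction on the dimension: fix the first coordinate, apply the induction
   hypothesis to the slice, and integrate over the first coordinate. *)
Lemma cube_cover m (l s : R) (P : nat -> bool) (a b : nat -> nat -> R) : 0 <= s ->
  (forall k i, (i < m)%N -> a k i <= b k i) ->
  (forall x : nat -> R, (forall i, (i < m)%N -> l <= x i <= l + s) ->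
     exists2 k, P k & forall i, (i < m)%N -> a k i <= x i <= b k i) ->
  ((s ^+ m)%:E <= \sum_(0 <= k <oo) ((P k)%:R * \prod_(i < m) (b k i - a k i))%:E)%E.
Proof.
move=> s0; elim: m P a b => [|m IH] P a b ab cov.
  have [k Pk _] := cov (fun=> 0) (fun i => ltac:(done)).
  rewrite expr0; apply: le_trans (@nneseries_lim_ge R _ xpredT 0 k.+1 _) => [|i _ _];
    last first.
    by rewrite big_ord0 lee_fin mulr_ge0.
  rewrite big_nat_recr //= Pk big_ord0 mulr1 leeDr //.
  by apply: sume_ge0 => i _; rewrite big_ord0 lee_fin mulr_ge0.
pose w k : R := (P k)%:R * \prod_(i < m) (b k i.+1 - a k i.+1).
have w0 k : 0 <= w k.
  by apply: mulr_ge0 => //; apply: prodr_ge0 => i _; rewrite subr_ge0 ab // ltnS.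
pose I k : set R := `[a k 0%N, b k 0%N]%classic.
pose f k (t : R) : \bar R := ((w k)%:E * (\1_(I k) t)%:E)%E.
pose D : set R := `[l, l + s]%classic.
have f0 k t : D t -> (0 <= f k t)%E by move=> _; rewrite mule_ge0 // lee_fin.
have mD : measurable D by exact: measurable_itv.
have mI k : measurable (I k) by exact: measurable_itv.
have mi k : measurable_fun D ((fun t => (\1_(I k) t)%:E) : R -> \bar R).
  by apply/measurable_EFinP; exact: measurable_indic.
have mf k : measurable_fun D (f k) by apply: measurable_funeM; exact: mi.
have slice t : D t -> ((s ^+ m)%:E <= \sum_(0 <= k <oo) f k t)%E.
  rewrite /D /= in_itv /= => Dt.
  have := IH (fun k => P k && (a k 0%N <= t <= b k 0%N)) (fun k i => a k i.+1) (fun k i =>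
    b k i.+1).
  move=> h; apply: (le_trans (h _ _)); clear h.
  - by move=> k i im; apply: ab.
  - move=> x hx.
    have [|k Pk hk] := cov (fun i => if i is j.+1 then x j else t).
      by case=> [_|i im] //; apply: hx.
    exists k; first by rewrite Pk /=; exact: (hk 0%N).
    by move=> i im; exact: (hk i.+1).
  - apply: lee_nneseries => [k _ _|k _].
      rewrite lee_fin; apply: mulr_ge0 => //; apply: prodr_ge0 => i _.
      by rewrite subr_ge0 ab // ltnS.
    rewrite /f -EFinM lee_fin /w indicE.
    have -> : (t \in I k) = (a k 0%N <= t <= b k 0%N) by apply/idP/idP => [/set_mem|h];
      [|apply/mem_set]; rewrite /I /= in_itv.
    by case: (P k) (a k 0%N <= t <= b k 0%N) => -[] /=;
      rewrite ?(mul0r, mul1r, mulr0, mulr1).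
have muD : mu D = s%:E.
  rewrite /D lebesgue_measure_itv /= lte_fin ltrDl; case: ltP => s0'.
    by rewrite -EFinB addrC addKr.
  by congr EFin; apply/le_anti/andP.
have e1 : (\int[mu]_(t in D) (s ^+ m)%:E = (s ^+ m.+1)%:E)%E.
  transitivity ((s ^+ m)%:E * mu D)%E; last by rewrite muD exprSr.
  by apply: integral_cst; exact: measurable_itv.
rewrite -e1; apply: le_trans (_ : \int[mu]_(t in D) \sum_(0 <= k <oo) f k t <= _)%E.
  apply: ge0_le_integral.
  - exact: measurable_itv.
  - by move=> t _; rewrite lee_fin exprn_ge0.
  - exact: measurable_cst.
  - by apply: ge0_emeasurable_sum => [k t Dt _|k _]; [exact: f0|exact: mf].
  - exact: slice.
rewrite integral_nneseries //; apply: lee_nneseries => [k _ _|k _].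
  by apply: integral_ge0 => t; exact: f0.
have -> : (\int[mu]_(t in D) f k t = (w k)%:E * mu (I k `&` D))%E.
  transitivity ((w k)%:E * \int[mu]_(t in D) (\1_(I k) t)%:E)%E.
    apply: ge0_integralZl_EFin; [exact: mD| |exact: mi|exact: w0].
    by move=> t _; rewrite lee_fin.
  by congr (_ * _)%E; apply: integral_indic; [exact: mD|exact: mI].
apply: (@le_trans _ _ ((w k)%:E * mu (I k))%E).
  apply: lee_wpmul2l; first by rewrite lee_fin.
  apply: (@le_measure _ _ _ (@lebesgue_measure R)); last exact: subIsetl.
    by apply/mem_set; apply: measurableI; [exact: mI|exact: mD].
  by apply/mem_set; exact: mI.
rewrite /I lebesgue_measure_itv /= lte_fin; case: ltP => k0.
  rewrite -EFinB -EFinM lee_fin /w big_ord_recl /= le_eqVlt; apply/orP; left; apply/eqP.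
  by rewrite -mulrA [X in _ * X]mulrC.
rewrite mule0 lee_fin; apply: mulr_ge0 => //; apply: prodr_ge0 => i _.
by rewrite subr_ge0 ab.
Qed.

Variable n : nat.
Implicit Types A B : set 'rV[R]_n.

(** Upper bounds on [vol] need a single covering, but positivity needs a bound valid for all of
    them; cubes suffice, since the sets considered later contain one. *)
Lemma vol_ge_cube A (l s : R) : 0 <= s ->
  (forall y : 'rV[R]_n, (forall i, l <= y 0 i <= l + s) -> A y) -> ((s ^+ n)%:E <= vol A)%E.
Proof.
move=> s0 cA; apply: le_ereal_inf_tmp => _ [a [b [ab cov ->]]].
(* Rows are extended by 0 to sequences, the form in which [cube_cover] runs its induction on the
   dimension. *)
pose u (x : 'rV[R]_n) (i : nat) : R := oapp (fun j : 'I_n => x 0 j) 0 (insub i).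
have uE x (i : 'I_n) : u x i = x 0 i by rewrite /u valK.
apply: le_trans (@cube_cover n l s xpredT (u \o a) (u \o b) s0 _ _) _.
- by move=> k i im /=; rewrite -[i]/(val (Ordinal im)) !uE.
- move=> x hx; have [|k _ hk] := cov (\row_(i < n) x i).
    by apply: cA => i; rewrite mxE hx.
  exists k => // i im /=; rewrite -[i]/(val (Ordinal im)) !uE.
  by have := hk (Ordinal im); rewrite mxE.
- apply: lee_nneseries => [k _ _|k _].
    rewrite mul1r lee_fin; apply: prodr_ge0 => i _.
    by rewrite /= !uE subr_ge0.
  rewrite mul1r lee_fin le_eqVlt; apply/orP; left; apply/eqP.
  by apply: eq_bigr => i _ /=; rewrite !uE.
Qed.

(** A covering of [B] scaled by [r] covers [A]. This inequality, used in both directions between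
    nearby indicatrices, replaces any finer property of Lebesgue measure. *)
Lemma vol_scale A B (r : R) : 0 < r -> (forall v, A v -> B (r^-1 *: v)) ->
  (vol A <= (r ^+ n)%:E * vol B)%E.
Proof.
move=> r0 AB; have rn0 : 0 < r ^+ n by rewrite exprn_gt0.
rewrite -lee_pdivrMl //; apply: le_ereal_inf_tmp => _ [a [b [ab cov ->]]].
rewrite lee_pdivrMl //; apply: ereal_inf_lbound.
exists (fun k => r *: a k), (fun k => r *: b k); split.
- by move=> k i; rewrite !mxE ler_pM2l.
- move=> v /AB /cov[k _ hk]; exists k => // i; have := hk i.
  rewrite !mxE => /andP[h1 h2].
  by rewrite -ler_pdivlMl // h1 /= -ler_pdivrMl.
- rewrite -nneseriesZl; last first.
    by move=> k _; rewrite lee_fin; apply: prodr_ge0 => i _; rewrite subr_ge0.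
  apply: eq_eseriesr => k _; rewrite -EFinM; congr EFin.
  under [RHS]eq_bigr do rewrite !mxE -mulrBr.
  by rewrite big_split /= prodr_const card_ord.
Qed.

Lemma vol_lty A (C : R) : (0 < n)%N -> (forall y, A y -> forall i,
  - C <= y 0 i <= C) -> (vol A < +oo)%E.
Proof.
move=> n0 AC; have [A0|/set0P[y0 Ay0]] := eqVneq A set0.
  apply: le_lt_trans (ltry 0); apply: ereal_inf_lbound.
  exists (fun=> 0), (fun=> 0); split => //; first by rewrite A0.
  rewrite eseries0 // => k _ _; congr EFin.
  by rewrite (bigD1 (Ordinal n0)) //= subrr mul0r.
have C0 : - C <= C by have /andP[h1 h2] := AC _ Ay0 (Ordinal n0); exact: le_trans h2.
apply: le_lt_trans (ltry ((C - - C) ^+ n)); apply: ereal_inf_lbound.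
(* One genuine box, followed by boxes reduced to the origin, whose volume is 0 because [0 < n]. *)
exists (fun k => if k is 0 then const_mx (- C) else 0),
  (fun k => if k is 0 then const_mx C else 0).
split.
- by move=> [|k] i; rewrite ?mxE.
- by move=> y Ay; exists 0%N => // i; rewrite !mxE; exact: AC.
- rewrite (nneseries_split 0 1) => [|k _]; last first.
    by rewrite lee_fin; apply: prodr_ge0 => i _; rewrite subr_ge0; case: k => [|k];
      rewrite ?mxE.
  rewrite eseries0 => [|[|k] // _ _]; last first.
    by congr EFin; rewrite (bigD1 (Ordinal n0)) //= subrr mul0r.
  rewrite addr0 big_nat1; congr EFin.
  by under [RHS]eq_bigr do rewrite !mxE; rewrite prodr_const card_ord.
Qed.

End Volume.

(** * Derivatives along curves *)

Lemma is_derive_cvg (R : realType) (V W : normedModType R) (f : V -> W) x v l : is_derive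
  x v f l ->
  (fun h : R => h^-1 *: (f (h *: v + x) - f x)) @ 0^' --> l.
Proof. by move=> [d <-]. Qed.

Lemma cvg_is_derive (R : realType) (V W : normedModType R) (f : V -> W) x v l :
  (fun h : R => h^-1 *: (f (h *: v + x) - f x)) @ 0^' --> l -> is_derive x v f l.
Proof.
by move=> c; split; [apply/cvg_ex; exists l|exact: cvg_lim c].
Qed.

Section DirectionalCalculus.
Variables (R : realType) (V : normedModType R).

Lemma is_derive_scale (W : normedModType R) (f : V -> W) x v (t : R) l : is_derive x v f l
  ->
  is_derive x (t *: v) f (t *: l).
Proof.
have [->|t0] := eqVneq t 0; first by move=> _; rewrite !scale0r; exact: is_derive0.
move=> /is_derive_cvg c; apply: cvg_is_derive.
have -> : (fun h : R => h^-1 *: (f (h *: (t *: v) + x) - f x)) =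
    (fun h => t *: ((fun h : R => h^-1 *: (f (h *: v + x) - f x)) (h * t))).
  by apply/funext => h /=; rewrite !scalerA invfM mulrCA mulfV // mulr1.
apply: cvgZl_tmp; apply: cvg_comp c => A /= [e /= e0 He].
exists (e / `|t|) => /=; first by rewrite divr_gt0 // normr_gt0.
move=> h /=; rewrite sub0r normrN ltr_pdivlMr ?normr_gt0 // -normrM => he h0.
by apply: He => /=; rewrite ?sub0r ?normrN // mulf_neq0.
Qed.

(** For locally Lipschitz [f] the difference quotients along the curve and along its tangent line
    differ by at most C times the distance between the quotient of the curve and [y], which tends to
    0. *)
Lemma derive_along_curve (f : V -> R) (gam : R -> V) x y s d C : 0 < d ->
  (forall z z', `|x - z| < d -> `|x - z'| < d -> `|f z - f z'| <= C * `|z - z'|) ->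
  gam 0 = x -> is_derive (0 : R) 1 gam y -> is_derive (0 : R) 1 (f \o gam) s ->
  is_derive x y f s.
Proof.
move=> d0 Lip g0 dg dfg; apply: cvg_is_derive.
have cg := is_derive_cvg dg; have cfg := is_derive_cvg dfg.
pose q (h : R) : R := h^-1 *: (f (h *: y + x) - f x).
pose q' (h : R) : R := h^-1 *: ((f \o gam) (h *: 1 + 0) - (f \o gam) 0).
pose r (h : R) : V := h^-1 *: (gam (h *: 1 + 0) - gam 0).
have cr : (fun h => C * `|r h - y|) @ 0^' --> (0 : R).
  have c1 : (fun h => `|r h - y|) @ 0^' --> `|y - y|.
    by apply: cvg_norm; apply: cvgB; [exact: cg|exact: cvg_cst].
  rewrite subrr normr0 in c1.
  by have := cvgMl_tmp (a := C) c1; rewrite mulr0; apply.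
have nr : \forall h \near (0:R)^', `|x - (h *: y + x)| < d.
  have [e e0 he] : exists2 e : R, 0 < e & forall h, `|h| < e -> `|h *: y| < d.
    exists (d / (`|y| + 1)); first by rewrite divr_gt0 // ltr_wpDl.
    move=> h; rewrite ltr_pdivlMr ?ltr_wpDl // => he.
    rewrite normrZ; apply: le_lt_trans he; apply: ler_wpM2l => //; lra.
  apply: nbhs_dnbhs; apply: filterS (nbhs0_lt e0) => h /he hd.
  by rewrite opprD addrCA subrr addr0 normrN.
have nc : \forall h \near (0:R)^', `|x - gam (h *: 1 + 0)| < d.
  have cgam : {for 0, continuous gam}.
    by apply/differentiable_continuous/derivable1_diffP; case: dg.
  have n : \forall h \near (0 : R), `|gam 0 - gam h| < d.
    by move/cvgrPdist_lt : cgam; apply.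
  apply: nbhs_dnbhs; apply: filterS n => h; rewrite g0.
  by rewrite addr0 /GRing.scale /= mulr1.
have qq : (fun h => q h - q' h) @ 0^' --> (0 : R).
  apply/norm_cvg0P; apply: (squeeze_cvgr _ (cvg_cst 0) cr).
  have n0 : \forall h \near (0:R)^', h != 0 by exact: nbhs_dnbhs_neq.
  apply: filterS3 nr nc n0 => h h1 h2 h0; rewrite normr_ge0 /=.
  rewrite /q /q' -scalerBr /= g0 opprB addrA subrK normrZ normfV.
  rewrite ler_pdivrMl ?normr_gt0 //; apply: le_trans (Lip _ _ h1 h2) _.
  rewrite [leRHS]mulrCA -normrZ scalerBr /r scalerA mulfV // scale1r g0.
  rewrite [X in _ <= C * X]distrC opprB addrA.
  by [].
have : (fun h => (q h - q' h) + q' h) @ 0^' --> 0 + s by apply: cvgD.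
by rewrite add0r; apply: cvg_trans; apply: near_eq_cvg; near=> h; rewrite subrK.
Unshelve. all: by end_near. Qed.

(** Additivity of directional derivatives without differentiability: the increment along u + v is
    split into one along [u] and one along [v]. The second starts from a moving point and is
    controlled by the mean value theorem and the continuity of [D] in its base point. One-sided
    limits suffice and fit [MVT_line], stated for positive increments. *)
Lemma is_derive_add (f : V -> R) (D : V -> V -> R) x u v (U : set V) : open U -> U x ->
  (forall z w, U z -> is_derive z w f (D z w)) -> {for x, continuous (D ^~ v)} ->
  D x (u + v) = D x u + D x v.
Proof.
move=> oU Ux df cD.
pose q w (h : R) : R := h^-1 *: (f (h *: w + x) - f x).
have cq w : q w @ 0^'+ --> D x w by apply: cvg_dnbhs_at_right;
  exact: is_derive_cvg (df _ _ Ux).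
pose r (h : R) : R := h^-1 *: (f (h *: v + (h *: u + x)) - f (h *: u + x)).
have cr : r @ 0^'+ --> D x v.
  apply/cvgrPdist_lt => e e0.
  have [d /= d0 hd] : exists2 d : R, 0 < d & forall z,
    `|x - z| < d -> U z /\ `|D x v - D z v| < e.
    have : \forall z \near x, U z /\ `|D x v - D z v| < e.
      by apply: filterS2 (open_near oU Ux) (continuous_near_lt cD e0).
    move=> /nbhs_ballP[d /= d0 H]; exists d => // z xz; apply: H.
    by rewrite -ball_normE.
  pose m := `|u| + `|v| + 1.
  have m0 : 0 < m by rewrite ltr_wpDl // addr_ge0.
  have hm : \forall h \near (0:R)^'+, h < d / m by apply: nbhs_right_lt; rewrite divr_gt0.
  have h0 : \forall h \near (0:R)^'+, 0 < h by exact: nbhs_right_gt.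
  apply: filterS2 hm h0 => h hm h0.
  have box t : 0 <= t <= h -> `|x - (t *: v + (h *: u + x))| < d.
    move=> /andP[t0 th]; rewrite addrA opprD addrCA subrr addr0 normrN.
    apply: le_lt_trans (ler_normD _ _) _; rewrite !normrZ !ger0_norm // ?(ltW h0) //.
    move: hm; rewrite ltr_pdivlMr //; apply: le_lt_trans.
    rewrite /m mulrDr mulr1 mulrDr addrC; apply: ler_wpDr; first exact: ltW.
    by apply: lerD => //; apply: ler_wpM2r.
  have [|t /andP[/ltW t0 /ltW th] mv] := @MVT_line R V f (h *: u + x) v h h0.
    by move=> t th; have [Uz _] := hd _ (box _ th); have [] := df _ v Uz.
  have [Uz he] := hd _ (box t (introT andP (conj t0 th))).
  have [_ dE] := df _ v Uz; rewrite dE in mv.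
  by rewrite /r mv /GRing.scale /= mulKf ?gt_eqF.
have : (fun h => q u h + r h) @ 0^'+ --> D x u + D x v by apply: cvgD.
have -> : (fun h => q u h + r h) = q (u + v).
  apply/funext => h; rewrite /q /r -scalerDr; congr (_ *: _).
  by rewrite [LHS]addrC addrA subrK scalerDr [h *: u + h *: v]addrC -[h *: v + h *: u +
    x]addrA.
by apply: cvg_unique; [exact: norm_hausdorff|exact: cq].
Qed.

End DirectionalCalculus.

(** * Volume of the indicatrix *)

Lemma continuous_at_sum (R : realType) (T : topologicalType) I (r : seq I) (F : I -> T ->
  R) z :
  (forall i, {for z, continuous (F i)}) -> {for z,
    continuous (fun x => \sum_(i <- r) F i x)}.
Proof.
move=> cF; elim: r => [|i r IH].
  have -> : (fun x => \sum_(i <- [::]) F i x) = cst 0 by apply/funext => x; rewrite big_nil.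
  exact: cvg_cst.
have -> : (fun x => \sum_(j <- i :: r) F j x) = (fun x => F i x + \sum_(j <- r) F j x).
  by apply/funext => x; rewrite big_cons.
by apply: cvgD; [exact: cF|exact: IH].
Qed.

Section LogVolume.
Variables (R : realType) (n : nat) (U : set 'rV[R]_n) (oU : open U) (n_gt0 : (0 < n)%N).
Variable L : 'rV[R]_n -> 'rV[R]_n -> R.
Hypothesis L_smooth : smooth_on (slit U) (fun z => L z.1 z.2).
Hypothesis L_homog : forall x y t, U x -> 0 < t -> L x (t *: y) = t * L x y.
Hypothesis L_gt0 : forall x (y : 'rV[R]_n), U x -> y != 0 -> 0 < L x y.

Lemma L_at0 x : U x -> L x 0 = 0.
Proof.
move=> Ux; have := L_homog 0 Ux (ltr0n R 2); rewrite scaler0 => e; lra.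
Qed.

Lemma norm_coord (v : 'rV[R]_n) i : `|v 0 i| <= `|v|.
Proof.
rewrite [leRHS]mx_normrE; exact: (le_bigmax _ (fun k => `|v k.1 k.2|) (0, i)).
Qed.

Lemma sphere_compact : compact [set v : 'rV[R]_n | `|v| = 1].
Proof.
apply: bounded_closed_compact.
  by exists 1; split; [exact: num_real|move=> M M1 v /= ->; exact: ltW].
have -> : [set v : 'rV[R]_n | `|v| = 1] = (fun v : 'rV[R]_n => `|v|) @^-1` [set 1] by [].
apply: closed_comp => [v _|]; first exact: norm_continuous.
exact: (accessible_closed_set1 (hausdorff_accessible (@norm_hausdorff _ _))).
Qed.

Lemma cball_compact (x0 : 'rV[R]_n) (r : R) : compact [set x : 'rV[R]_n | `|x0 - x| <= r].
Proof.
apply: bounded_closed_compact; last exact: closed_closed_ball_.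
exists (`|x0| + r); split; first exact: num_real.
move=> M M1 x /= xr; apply: le_trans (ltW M1).
by rewrite -[x](subKr x0); apply: le_trans (ler_normB _ _) _; rewrite lerD2l.
Qed.

(** Extrema over the compact product of a closed ball and the unit sphere, on which F is smooth and
    positive. *)
Lemma local_bounds x0 : U x0 -> exists d m M C1, [/\ 0 < d, 0 < m & forall x,
  `|x0 - x| < d -> U x /\
  forall v : 'rV[R]_n, `|v| = 1 -> [/\ m <= L x v,
    L x v <= M & \sum_i `|dx i L x v| <= C1]].
Proof.
move=> Ux0; have [e /= e0 eU] : exists2 e : R, 0 < e & forall x, `|x0 - x| < e -> U x.
  move: (open_near oU Ux0) => /nbhs_ballP[e /= e0 H]; exists e => // x xe; apply: H.
  by rewrite -ball_normE.
pose B := [set x : 'rV[R]_n | `|x0 - x| <= e / 2].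
pose S := [set v : 'rV[R]_n | `|v| = 1].
have BU x : B x -> U x.
  move=> Bx; apply: eU; apply: le_lt_trans Bx _; by lra.
have cK : compact (B `*` S) := compact_setX (@cball_compact x0 (e / 2)) sphere_compact.
have KO z : (B `*` S) z -> slit U z.
  move=> [/BU Uz Sz]; split => //; apply/eqP => z0; move: Sz;
    rewrite /S /= z0 normr0 => /eqP.
  by rewrite eq_sym oner_eq0.
have K0 : (B `*` S) !=set0.
  pose w : 'rV[R]_n := const_mx 1.
  have w0 : w != 0 by apply/eqP => /rowP/(_ (Ordinal n_gt0))/eqP; rewrite !mxE oner_eq0.
  exists (x0, `|w|^-1 *: w); split; rewrite /B /S /=.
    by rewrite subrr normr0 divr_ge0 // ltW.
  by rewrite normrZ normfV normr_id mulVf // normr_eq0.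
have cL : {within B `*` S, continuous (fun z => L z.1 z.2)}.
  apply: continuous_in_subspaceT => z /set_mem Kz.
  exact: smooth_continuous L_smooth (KO _ Kz).
pose sL : smfun (slit U) := mksm (fun=> L_smooth).
have rL : rep L sL by move=> x y Ux y0; rewrite smev_mksm //; split.
have cD : {within B `*` S, continuous (fun z => \sum_i `|smev (smX i sL) z|)}.
  apply: continuous_in_subspaceT => z /set_mem Kz.
  apply: continuous_at_sum => i.
  apply: (@continuous_comp _ _ _ (smev (smX i sL)) (fun r : R => `|r|));
    last exact: norm_continuous.
  exact: smooth_continuous (smev_smooth _ (open_slit oU)) (KO _ Kz).
have [z1 /set_mem Kz1 min1] := compact_EVT_min K0 cK cL.
have [z2 _ max2] := compact_EVT_max K0 cK cL.
have [z3 _ max3] := compact_EVT_max K0 cK cD.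
exists (e / 2), (L z1.1 z1.2), (L z2.1 z2.2), (\sum_i `|smev (smX i sL) z3|).
split; first by rewrite divr_gt0.
  by have [U1 U2] := KO _ Kz1; exact: L_gt0.
move=> x xd; have Bx : B x by exact: ltW.
split=> [|v v1]; first exact: BU.
have Kxv : (x, v) \in B `*` S by apply/mem_set; split.
have [Ux v0] := KO _ (set_mem Kxv).
split; [exact: min1 Kxv|exact: max2 Kxv|].
apply: le_trans (max3 _ Kxv); rewrite le_eqVlt; apply/orP; left; apply/eqP.
by apply: eq_bigr => i _; rewrite (rep_dx oU i rL).
Qed.

(** The Lipschitz bound in [x] is multiplicative: proved for unit vectors, it extends to all [v] by
    homogeneity, and it translates into inclusions between scaled indicatrices. *)
Lemma local_lipschitz x0 : U x0 -> exists d m M C, [/\ 0 < d, 0 < m, 0 < M, 0 <= C &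
  forall x x', `|x0 - x| < d -> `|x0 - x'| < d -> U x /\ forall v,
    [/\ m * `|v| <= L x v, L x v <= M * `|v| & L x' v <= (1 + C * `|x - x'|) * L x v]].
Proof.
move=> Ux0; have [d [m [M [C1 [d0 m0 H]]]]] := local_bounds Ux0.
have C10 : 0 <= C1.
  have [_ H0] := H x0 (ltac:(by rewrite subrr normr0)).
  pose w : 'rV[R]_n := const_mx 1.
  have w0 : w != 0 by apply/eqP => /rowP/(_ (Ordinal n_gt0))/eqP; rewrite !mxE oner_eq0.
  have [|_ _] := H0 (`|w|^-1 *: w).
    by rewrite normrZ normfV normr_id mulVf // normr_eq0.
  by apply: le_trans; apply: sumr_ge0.
(* [M] is enlarged to be visibly positive. On unit vectors the additive constant [C1] becomes the
   multiplicative constant [C1 / m] because F is at least [m] there. *)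
exists d, m, (`|M| + 1), (C1 / m); split=> //.
  by rewrite divr_ge0 // ltW.
move=> x x' xd xd'; have [Ux Hx] := H x xd; have [Ux' Hx'] := H x' xd'.
split => // v; have [->|v0] := eqVneq v 0; first by rewrite !L_at0 // normr0 !mulr0.
have nv0 : 0 < `|v| by rewrite normr_gt0.
pose u := `|v|^-1 *: v.
have u1 : `|u| = 1 by rewrite /u normrZ normfV normr_id mulVf // gt_eqF.
have vu : v = `|v| *: u by rewrite /u scalerA mulfV ?scale1r // gt_eqF.
have u0 : u != 0 by rewrite -normr_gt0 u1.
have Lxv : L x v = `|v| * L x u by rewrite {1}vu L_homog.
have Lxv' : L x' v = `|v| * L x' u by rewrite {1}vu L_homog.
have [h1 h2 _] := Hx u u1.
rewrite Lxv Lxv'; split.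
- by rewrite mulrC ler_pM2l.
- rewrite mulrC ler_pM2r //; apply: le_trans h2 _.
  by apply: le_trans (ler_norm M) _; rewrite lerDl.
rewrite mulrCA ler_pM2l //.
have sm := smooth_slice oU u0 L_smooth.
have seg t : 0 <= t <= 1 -> `|x0 - (t *: (x' - x) + x)| < d.
  move=> /andP[t0 t1].
  have -> : x0 - (t *: (x' - x) + x) = t *: (x0 - x') + (1 - t) *: (x0 - x).
    rewrite !scalerBr !scalerBl !scale1r; apply/rowP => j; rewrite !mxE; ring.
  apply: le_lt_trans (ler_normD _ _) _; rewrite !normrZ !ger0_norm ?subr_ge0 //.
  have [->|tn0] := eqVneq t 0; first by rewrite mul0r add0r subr0 mul1r.
  have -> : d = t * d + (1 - t) * d by ring.
  apply: ltr_leD; first by rewrite ltr_pM2l // lt_def tn0.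
  by apply: ler_wpM2l; [rewrite subr_ge0|exact: ltW].
have [|t /andP[/ltW t0 /ltW t1]] := @MVT_line R _ (fun x => L x u) x (x' - x) 1 ltr01.
  move=> t t01; have [Uz _] := H _ (seg t t01).
  exact: smooth_derivable sm Uz.
have [Uz Hz] := H _ (seg t (introT andP (conj t0 t1))).
rewrite scale1r subrK mul1r (deriveE _ (smooth_diff sm Uz)) => mv.
have bound : 'd (fun x => L x u) (t *: (x' - x) + x) (x' - x) <= C1 * `|x - x'|.
  rewrite [X in 'd _ _ X](row_sum_delta (x' - x)) linear_sum.
  apply: le_trans (ler_norm _) _; apply: le_trans (ler_norm_sum _ _ _) _.
  have [_ _ h3] := Hz u u1.
  apply: le_trans (_ : (\sum_i `|dx i L (t *: (x' - x) + x) u|) * `|x - x'| <= _);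
    last first.
    by apply: ler_wpM2r.
  rewrite mulr_suml; apply: ler_sum => i _; rewrite linearZ normrM mulrC.
  rewrite -(deriveE _ (smooth_diff sm Uz)).
  by apply: ler_wpM2l => //; rewrite distrC; exact: norm_coord.
rewrite -(subrK (L x u) (L x' u)) mv mulrDl mul1r addrC lerD2l.
apply: le_trans bound _.
have -> : C1 / m * `|x - x'| * L x u = C1 * `|x - x'| * (m^-1 * L x u) by ring.
apply: ler_peMr; first exact: mulr_ge0.
by rewrite ler_pdivlMl // mulr1.
Qed.

Definition indicatrix x : set 'rV[R]_n := [set v | L x v < 1].
Definition Vol x : R := fine (vol (indicatrix x)).

Lemma vol_indicatrix x : U x -> (0%E < vol (indicatrix x) < +oo)%E.
Proof.
move=> Ux; have [d [m [M [C [d0 m0 M0 C0 H]]]]] := local_lipschitz Ux.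
have xx : `|x - x| < d by rewrite subrr normr0.
have [_ {}H] := H x x xx xx.
apply/andP; split.
  (* The norm is the sup norm, so the cube of half-side [s] is a norm ball, on which F is at most M
     s = 1/2. *)
  pose s := (M + M)^-1.
  have s0 : 0 < s by rewrite invr_gt0 addr_gt0.
  apply: lt_le_trans (_ : ((s + s) ^+ n)%:E <= _)%E;
    first by rewrite lte_fin exprn_gt0 // addr_gt0.
  apply: (@vol_ge_cube _ _ _ (- s)); first by rewrite ltW // addr_gt0.
  move=> v hv; rewrite /indicatrix /=; have [_ h _] := H v; apply: le_lt_trans h _.
  have vs : `|v| <= s.
    rewrite [leLHS]mx_normrE; apply/bigmax_leP; split; first exact: ltW.
    by move=> [j i] _ /=; rewrite (ord1 j) ler_norml; have := hv i;
      rewrite addrA addNr add0r.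
  apply: le_lt_trans (_ : M * s < _); first by rewrite ler_pM2l.
  rewrite /s -[X in X / _]mulr1 -{1}(@mulfV _ M) ?gt_eqF // ;
    rewrite ltr_pdivrMr ?addr_gt0 //.
  by rewrite mulfV ?gt_eqF // mulr1 mul1r ltrDl.
apply: (@vol_lty _ _ _ m^-1) => // v; rewrite /indicatrix /= => v1 i.
have [h _ _] := H v; rewrite -ler_norml; apply: le_trans (norm_coord v i) _.
by rewrite -[leRHS]mulr1 ler_pdivlMl //; apply: le_trans h _; exact: ltW.
Qed.

Lemma Vol_gt0 x : U x -> 0 < Vol x.
Proof. by move=> /vol_indicatrix; exact: fine_gt0. Qed.

Definition logVol x : R := ln (Vol x).

(** With r = 1 + C|x - x'| the indicatrix at [x] lies in r times that at [x'], so the volumes have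
    ratio at most r^n, and n ln r is at most n C |x - x'|. Exchanging the points gives the other
    sign. *)
Lemma logVol_lipschitz x0 : U x0 -> exists d C, 0 < d /\ forall x x',
  `|x0 - x| < d -> `|x0 - x'| < d -> `|logVol x - logVol x'| <= C * `|x - x'|.
Proof.
move=> Ux0; have [d [m [M [C [d0 m0 M0 C0 H]]]]] := local_lipschitz Ux0.
exists d, (n%:R * C); split => //.
have half x x' : `|x0 - x| < d -> `|x0 - x'| < d -> logVol x - logVol x' <= n%:R * C * `|x
  - x'|.
  move=> xd xd'; have [Ux Hx] := H x x' xd xd'; have [Ux' _] := H x' x xd' xd.
  pose r := 1 + C * `|x - x'|.
  have r0 : 0 < r by rewrite ltr_pwDl // mulr_ge0.
  have /andP[vx0 vxy] := vol_indicatrix Ux.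
  have /andP[vx0' vxy'] := vol_indicatrix Ux'.
  have le1 : (vol (indicatrix x) <= (r ^+ n)%:E * vol (indicatrix x'))%E.
    apply: vol_scale => // v; rewrite /indicatrix /= => v1.
    have [_ _ h] := Hx v; rewrite L_homog ?invr_gt0 // ltr_pdivrMl // mulr1.
    by apply: le_lt_trans h _; rewrite -/r gtr_pMr.
  have le2 : Vol x <= r ^+ n * Vol x'.
    rewrite -lee_fin EFinM /Vol !fineK ?ge0_fin_numE //; exact: ltW.
  rewrite lerBlDr; apply: le_trans (_ : ln (r ^+ n * Vol x') <= _).
    by rewrite ler_ln // posrE ?mulr_gt0 ?exprn_gt0 // Vol_gt0.
  rewrite lnM ?posrE ?exprn_gt0 ?Vol_gt0 // lnXn // lerD2r.
  rewrite -[leLHS]mulr_natl -mulrA; apply: ler_wpM2l => //; apply: le_ln1Dx.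
  by apply: lt_le_trans (_ : 0 <= _); rewrite ?ltrN10 // mulr_ge0.
move=> x x' xd xd'; rewrite ler_norml half // andbT lerNl opprB distrC; exact: half.
Qed.

End LogVolume.

(** * Isotropic S-curvature in a chart *)

Section IsotropicScurvature.
Variables (R : realType) (n : nat) (U : set 'rV[R]_n) (oU : open U).
Variable L : 'rV[R]_n -> 'rV[R]_n -> R.
Hypothesis L_smooth : smooth_on (slit U) (fun z => L z.1 z.2).
Hypothesis L_homog : forall x y t, U x -> 0 < t -> L x (t *: y) = t * L x y.
Hypothesis L_ge0 : forall x y, U x -> 0 <= L x y.
Hypothesis L_posdef : forall x (y u : 'rV[R]_n),
  U x -> y != 0 -> u != 0 -> 0 < ginner L x y u u.
Hypothesis n_gt0 : (0 < n)%N.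
Variable c : 'rV[R]_n -> R.
Hypothesis c_smooth : smooth_on U c.
Hypothesis S_isotropic : forall x (y : 'rV[R]_n), U x -> y != 0 ->
  S_curvature_is U L x y ((n.+1)%:R * c x * L x y).

Let L_pos x (y : 'rV[R]_n) : U x -> y != 0 -> 0 < L x y :=
  @metric_gt0 R n U oU L L_smooth L_homog L_ge0 L_posdef x y.
Let h_ := smh oU L_smooth L_posdef.
Local Notation A := (smfun (slit U)).
Local Notation gA := (fund (@smY R n U) (smhalf U) (smL L_smooth)).
Local Notation G := (geod (@smX R n U) (@smY R n U) (smcoord oU) (smhalf U) (smL L_smooth)
  h_).

(* The derivative of [logVol L] in the direction [y], read off the S-curvature. *)
Definition logvol_form (x y : 'rV[R]_n) : R :=
  (n.+1)%:R * c x * L x y - \sum_m dy m (spray L m) x y.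

Lemma unit_ball_vol : 0 < fine (vol (@unit_ball R n)).
Proof.
apply: fine_gt0; apply/andP; split; last first.
  apply: (@vol_lty _ _ _ 1 n_gt0) => v; rewrite /unit_ball /= => v1 i.
  rewrite -ler_norml -(@expr_le1 _ 2) // real_normK ?num_real //; apply: ltW.
  apply: le_lt_trans v1; rewrite (bigD1 i) //= lerDl.
  by apply: sumr_ge0 => j _; exact: sqr_ge0.
(* On the cube of side [s] at the origin the sum of squares is at most n s, which is below 1. *)
pose s : R := (n.+1)%:R^-1.
have s0 : 0 < s by rewrite invr_gt0.
apply: lt_le_trans (_ : (s ^+ n)%:E <= _)%E; first by rewrite lte_fin exprn_gt0.
apply: (@vol_ge_cube _ _ _ 0); first exact: ltW.
move=> v hv; rewrite /unit_ball /=.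
apply: (@le_lt_trans _ _ (\sum_(i < n) s)).
  apply: ler_sum => i _; have := hv i; rewrite add0r => /andP[v0 vs].
  rewrite expr2; apply: le_trans (_ : s * 1 <= _); last by rewrite mulr1.
  apply: ler_pM => //; apply: le_trans vs _.
  by rewrite invf_le1 // ler1n.
by rewrite sumr_const card_ord -mulr_natr mulrC /s ltr_pdivrMr // mul1r ltr_nat.
Qed.

Lemma geodesic_near_slit (y : 'rV[R]_n) gam : y != 0 -> geodesic_near0 U L gam ->
  derive1 gam 0 = y -> \forall t \near (0 : R), slit U (gam t, derive1 gam t).
Proof.
move=> y0 geo g1; have [_ dg dg' _] := nbhs_singleton geo.
have dg2 : differentiable (derive1 gam) (0 : R) := (derivable1_diffP _ _).1 dg'.
have ng' : \forall t \near (0 : R), derive1 gam t != 0.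
  have cg' : {for (0 : R), continuous (derive1 gam)} by exact: differentiable_continuous.
  have nb : nbhs (derive1 gam 0) (~` [set 0]).
    rewrite g1; apply: open_nbhs_nbhs; split; last exact/eqP.
    by apply: closed_openC; exact: (accessible_closed_set1 (hausdorff_accessible
      (@norm_hausdorff _ _))).
  have nb' : \forall t \near (0 : R), (~` [set 0]) (derive1 gam t) := cg' _ nb.
  by apply: filterS nb' => t /= /eqP.
by apply: filterS2 geo ng' => t [Ut _ _ _] gt0; split.
Qed.

(** By the geodesic equation the velocity of the lifted curve (gam, gam') at (x, y) is (y, -2G), the
    value of the spray vector field; hence the derivative is the one computed in [Gam_det]. *)
Lemma det_along x (y : 'rV[R]_n) gam : U x -> y != 0 -> geodesic_near0 U L gam -> gam 0 =
  x ->
  derive1 gam 0 = y ->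
  is_derive (0 : R) 1 (fun t => \det (gmx L (gam t) (derive1 gam t)))
    (2 * (\sum_m dy m (spray L m) x y) * \det (gmx L x y)).
Proof.
move=> Ux y0 geo g0 g1; have Oxy : slit U (x, y) by split.
have [_ dg dg' geq] := nbhs_singleton geo.
pose D := smev (\det gA).
have dD : differentiable D (x, y) := smooth_diff (smev_smooth _ (open_slit oU)) Oxy.
pose P t := (gam t, derive1 gam t).
have dg1 : differentiable gam (0 : R) := (derivable1_diffP _ _).1 dg.
have dg2 : differentiable (derive1 gam) (0 : R) := (derivable1_diffP _ _).1 dg'.
have dP : differentiable P (0 : R) by exact: differentiable_pair.
have P0 : P 0 = (x, y) by rewrite /P g0 g1.
have dDP : differentiable (D \o P) (0 : R) by apply: differentiable_comp; rewrite ?P0.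
have w i : derive1 (derive1 gam) 0 0 i = - (2 * spray L i x y).
  by apply/eqP; rewrite -addr_eq0; apply/eqP; have := geq i; rewrite g0 g1.
have DE : 'D_1 (D \o P) 0 = 2 * (\sum_m dy m (spray L m) x y) * \det (gmx L x y).
  have -> : 'D_1 (D \o P) 0 = 'd D (x, y) (y, derive1 (derive1 gam) 0).
    have dD' : differentiable D (P 0) by rewrite P0.
    rewrite (deriveE _ dDP) (diff_comp dP dD') P0 /=; congr ('d D (x, y) _).
    rewrite (diff_pair dg1 dg2) /=; congr pair.
      by rewrite -(deriveE _ dg1) -derive1E g1.
    by rewrite -(deriveE _ dg2) -derive1E.
  have -> : ((y, derive1 (derive1 gam) 0) : 'rV[R]_n * 'rV[R]_n) =
    \sum_i y 0 i *: (delta_mx 0 i, 0) + \sum_i (- (2 * spray L i x y)) *: (0, delta_mx 0 i).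
    rewrite [RHS]surjective_pairing /= !(raddf_sum fst) !(raddf_sum snd) /=; congr pair.
      rewrite [X in _ + X]big1 ?addr0 => [|i _ /=]; last by rewrite scaler0.
      by rewrite [LHS]row_sum_delta.
    rewrite [X in X + _]big1 ?add0r => [|i _ /=]; last by rewrite scaler0.
    by rewrite [LHS]row_sum_delta; apply: eq_bigr => i _; rewrite w.
  have := Gam_det (smXD oU) (smYD oU) (smXY oU) (smYY oU) (smYy oU) (smh2 U) (smfund_h oU
    L_smooth L_posdef).
  move=> /(congr1 (fun a : A => smev a (x, y))).
  rewrite (smevM _ (\det gA)) (rep_detg oU L_smooth Ux y0) (smevM 2) smev_nat // smev_sum.
  under eq_bigr do rewrite (rep_conn oU L_smooth L_posdef) //.
  move=> <-; rewrite linearD !linear_sum /Gam smevB (smevM 2) smev_nat // !smev_sum.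
  congr (_ + _).
    apply: eq_bigr => i _; rewrite linearZ (smevM (smcoord oU i)) (rep_coord oU) //.
    by rewrite (smev_smder _ _ Oxy) (deriveE _ dD).
  rewrite mulr_sumr -sumrN; apply: eq_bigr => i _; rewrite linearZ.
  rewrite (smevM (G i)) (rep_spray oU L_smooth L_posdef) // (smev_smder _ _ Oxy) (deriveE
    _ dD).
  by rewrite [LHS]scaleNr [in RHS]mulrA.
have dDP' : is_derive (0 : R) 1 (D \o P) (2 * (\sum_m dy m (spray L m) x y) * \det (gmx L
  x y)).
  by split => //; exact: diff_derivable.
apply: near_eq_is_derive dDP'.
have ng' := geodesic_near_slit y0 geo g1.
apply: filterS ng' => t [Ut gt0].
by rewrite /D /P /= (rep_detg oU L_smooth).
Qed.

Lemma ln_sqrt (r : R) : 0 < r -> ln (Num.sqrt r) = 2^-1 * ln r.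
Proof.
move=> r0; have s0 : 0 < Num.sqrt r by rewrite sqrtr_gt0.
have e : ln r = ln (Num.sqrt r) + ln (Num.sqrt r) by rewrite -lnM // -expr2 sqr_sqrtr //
  ltW.
by rewrite e; lra.
Qed.

Lemma ln_distortion (v0 v r : R) : 0 < v0 -> 0 < v -> 0 < r ->
  ln (Num.sqrt r / v0 * v) + - (2^-1 * ln r) + ln v0 = ln v.
Proof.
move=> v00 v_gt0 r0; have s0 : 0 < Num.sqrt r by rewrite sqrtr_gt0.
rewrite lnM ?posrE ?divr_gt0 // ln_div ?posrE // ln_sqrt //; ring.
Qed.

(** Along the geodesic, the distortion minus half the logarithm of det g is [logVol] up to a
    constant, so [logVol] has derivative S - Pi there; the Lipschitz bound transfers this from the
    geodesic to the straight line in direction [y]. *)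
Lemma logVol_derive x (y : 'rV[R]_n) : U x -> y != 0 ->
  is_derive x y (logVol L) (logvol_form x y).
Proof.
move=> Ux y0; have [gam [geo g0 g1 dS]] := S_isotropic Ux y0.
have [_ dg _ _] := nbhs_singleton geo.
have dg1 : is_derive (0 : R) 1 gam y by split; [exact: dg|rewrite -derive1E].
have [d [C [d0 Lip]]] := logVol_lipschitz oU n_gt0 L_smooth L_homog L_pos Ux.
apply: (derive_along_curve d0 Lip g0 dg1).
have det0 := det_gmx_gt0 L_posdef Ux y0.
pose D t := \det (gmx L (gam t) (derive1 gam t)).
have dD := det_along Ux y0 geo g0 g1.
have D0 : D 0 = \det (gmx L x y) by rewrite /D g0 g1.
have dlnD : is_derive (0 : R) 1 (@ln R \o D) ((D 0)^-1 * (2 * (\sum_m dy m (spray L m) x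
  y) * \det (gmx L x y))).
  have D00 : 0 < D 0 by rewrite D0.
  exact: (@is_derive1_comp R (@ln R) D 0 _ _ (is_derive1_ln D00) dD).
have dh : is_derive (0 : R) 1 (fun t => - (2^-1 * ln (D t))) (- \sum_m dy m (spray L m) x
  y).
  have d1 : is_derive (0 : R) 1 (2^-1 *: (@ln R \o D)) (2^-1 *: ((D 0)^-1 * (2 * (\sum_m
    dy m (spray L m) x y) * \det (gmx L x y)))).
    exact: is_deriveZ.
  have d2 := is_deriveN d1.
  apply: is_derive_eq; rewrite D0 /GRing.scale /=; congr (- _).
  by field; rewrite gt_eqF.
have dk : is_derive (0 : R) 1 (cst (ln (fine (vol (@unit_ball R n))))) (0 : R) by exact:
  is_derive_cst.
have d3 := is_deriveD (is_deriveD dS dh) dk.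
rewrite addr0 in d3; apply: near_eq_is_derive d3.
apply: filterS (geodesic_near_slit y0 geo g1) => t [Ut gt0] /=.
rewrite -![(_ + _ : _ -> _) _]/(_ + _) /cst /distortion -/(Vol L (gam t)) -/(D t).
have Dt : 0 < D t by exact: (det_gmx_gt0 L_posdef Ut gt0).
have Vt : 0 < Vol L (gam t) by exact: (Vol_gt0 oU n_gt0 L_smooth L_homog L_pos Ut).
exact: ln_distortion unit_ball_vol Vt Dt.
Qed.

Lemma rep_logvol_form : rep logvol_form
  ((n.+1)%:R * (smc oU c_smooth * smL L_smooth) - \tr (conn (@smY R n U) G)).
Proof.
have e : rep (fun x y => (n.+1)%:R * (c x * L x y) - \sum_m dy m (spray L m) x y)
    ((n.+1)%:R * (smc oU c_smooth * smL L_smooth) - \tr (conn (@smY R n U) G)).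
  apply: repB.
    by apply: repM; [exact: rep_nat|apply: repM; [exact: rep_c|exact: rep_L]].
  by apply: rep_sum => m _; exact: rep_conn.
by apply: rep_ext e => x y _ _; rewrite mulrA.
Qed.

Lemma logvol_form_smooth (y : 'rV[R]_n) : y != 0 -> smooth_on U (fun x => logvol_form x y).
Proof.
move=> y0; apply: (smooth_ext oU _ (smooth_slice oU y0 (smev_smooth _ (open_slit oU)))) =>
  x Ux.
exact: rep_logvol_form Ux y0.
Qed.

Definition logvol_coef m x : R := logvol_form x (delta_mx 0 m).

Lemma delta_mx_neq0 m : delta_mx 0 m != 0 :> 'rV[R]_n.
Proof. by apply/eqP => /rowP/(_ m)/eqP; rewrite !mxE !eqxx oner_eq0. Qed.

(** The formula for [logvol_form] is not visibly linear in [y]. It is linear as a directional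
    derivative of one function that depends continuously on the base point. *)
Lemma logvol_form_linear x (y : 'rV[R]_n) : U x -> y != 0 ->
  logvol_form x y = \sum_m y 0 m * logvol_coef m x.
Proof.
move=> Ux y0.
(* At w = 0 the spray, hence [logvol_form], has no meaning, while the directional derivative there
   is 0. *)
pose D z w := if w == 0 :> 'rV[R]_n then 0 else logvol_form z w.
have dD z w : U z -> is_derive z w (logVol L) (D z w).
  move=> Uz; rewrite /D; have [->|w0] := eqVneq w 0; first exact: is_derive0.
  exact: logVol_derive.
have cD v : {for x, continuous (D ^~ v)}.
  have [v0|v0] := eqVneq v 0.
    have -> : D ^~ v = cst 0 by apply/funext => z; rewrite /D v0 eqxx.
    exact: cst_continuous.
  have -> : D ^~ v = logvol_form ^~ v by apply/funext => z; rewrite /D (negbTE v0).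
  exact: smooth_continuous (logvol_form_smooth v0) Ux.
have Dadd u v : D x (u + v) = D x u + D x v := is_derive_add u oU Ux dD (cD v).
have D0 : D x 0 = 0 by rewrite /D eqxx.
have DZ t v : D x (t *: v) = t * D x v.
  have [_ <-] := dD x (t *: v) Ux.
  by have [_ ->] := is_derive_scale t (dD x v Ux).
have -> : logvol_form x y = D x y by rewrite /D (negbTE y0).
rewrite [in LHS](row_sum_delta y) (big_morph (D x) Dadd D0).
apply: eq_bigr => m _; rewrite DZ /logvol_coef; congr (_ * _).
by rewrite /D (negbTE (delta_mx_neq0 m)).
Qed.

Lemma logvol_coef_smooth m : smooth_on U (logvol_coef m).
Proof. exact: logvol_form_smooth (delta_mx_neq0 m). Qed.

Lemma logvol_coef_derive k z : U z -> 'D_(delta_mx 0 k) (logVol L) z = logvol_coef k z.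
Proof. by move=> Uz; have [_ ->] := logVol_derive Uz (delta_mx_neq0 k). Qed.

(** The coefficients are the partial derivatives of [logVol L] and are themselves smooth, so the
    mixed second derivatives exist and are continuous, as [schwarz] asks. *)
Lemma logvol_coef_closed i k x : U x -> partial i (logvol_coef k) x = partial k
  (logvol_coef i) x.
Proof.
move=> Ux; pose e m : 'rV[R]_n := delta_mx 0 m.
have d2 a b z : U z -> 'D_(e a) ('D_(e b) (logVol L)) z = partial a (logvol_coef b) z.
  by move=> Uz; exact: (derive_ext oU (e a) (logvol_coef_derive b) Uz).
have der a b z : U z -> derivable ('D_(e b) (logVol L)) z (e a).
  move=> Uz; apply: near_eq_derivable (smooth_derivable (logvol_coef_smooth b) Uz).
  by apply: filterS (open_near oU Uz) => w Uw; apply/esym; exact: logvol_coef_derive.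
have cont a b : {for x, continuous ('D_(e a) ('D_(e b) (logVol L)))}.
  have sm := smooth_derive (e a) (logvol_coef_smooth b).
  have : smooth_on U ('D_(e a) ('D_(e b) (logVol L))).
    by apply: (smooth_ext oU _ sm) => z Uz; apply/esym; exact: d2.
  by move=> s; exact: smooth_continuous s Ux.
rewrite -(d2 i k x Ux) -(d2 k i x Ux).
apply: (schwarz oU Ux) => [z Uz||]; [|exact: cont|exact: cont].
split; [| |exact: der|exact: der].
  by have [] := logVol_derive Uz (delta_mx_neq0 i).
by have [] := logVol_derive Uz (delta_mx_neq0 k).
Qed.

Lemma isotropic_rigidity (kap : 'rV[R]_n -> 'rV[R]_n -> R) : (2 <= n)%N ->
  (forall x y u, U x -> free [:: y; u] -> flag_curvature L x y u = kap x y) ->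
  forall x (y1 y2 : 'rV[R]_n), U x -> y1 != 0 -> y2 != 0 ->
  kap x y1 - 3 * ((\sum_m partial m c x * y1 0 m) / L x y1) =
  kap x y2 - 3 * ((\sum_m partial m c x * y2 0 m) / L x y2).
Proof.
move=> n2 flag x y1 y2 Ux y10 y20.
apply: (local_rigidity oU L_smooth L_homog L_ge0 L_posdef n2 flag c_smooth
  logvol_coef_smooth logvol_coef_closed) => // z y Uz y0.
(* Adding [logvol_form] back to the trace of the connection restores the isotropic S-curvature. *)
by rewrite -logvol_form_linear // /logvol_form addrC subrK mulrA.
Qed.

End IsotropicScurvature.

(** * Charts and tangent vectors *)

Section Charts.
Variables (R : realType) (n : nat) (M : manifold R n).
Implicit Types (phi psi : chart R n M) (p : M).

Lemma chart_img_of phi p : chart_dom phi p -> chart_img phi (phi p).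
Proof. by move=> dp; exists p. Qed.

Lemma chart_invK phi x : chart_img phi x -> phi (chart_inv phi x) = x.
Proof. by move=> [q dq <-]; rewrite chart_mapK. Qed.

Lemma near_chart_inv phi p (A : set M) : chart_dom phi p -> open A -> A p ->
  \forall x \near phi p, chart_img phi x /\ A (chart_inv phi x).
Proof.
move=> dp oA Ap; have ip := chart_img_of dp.
have n1 : \forall x \near phi p, chart_img phi x := open_near (@chart_img_open _ _ _ phi)
  ip.
have n2 : \forall x \near phi p, A (chart_inv phi x).
  have := chart_inv_cont ip; rewrite /prop_for /continuous_at chart_mapK // => c.
  by have := c A (open_nbhs_nbhs (conj oA Ap)).
by apply: filterS2 n1 n2.
Qed.

Lemma transition_at phi psi p : chart_dom phi p -> transition phi psi (phi p) = psi p.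
Proof. by move=> dp; rewrite /transition chart_mapK. Qed.

Lemma transition_diff phi psi p : atlas phi -> atlas psi -> chart_dom phi p -> chart_dom
  psi p ->
  differentiable (transition phi psi) (phi p).
Proof.
move=> aphi apsi dphi dpsi; have [d _] := atlas_smooth aphi apsi 1%N.
by apply: d; exists p.
Qed.

Lemma transition_diffK phi psi p v : atlas phi -> atlas psi -> chart_dom phi p ->
  chart_dom psi p ->
  'd (transition psi phi) (psi p) ('d (transition phi psi) (phi p) v) = v.
Proof.
move=> aphi apsi dphi dpsi.
have d1 := transition_diff aphi apsi dphi dpsi.
have d2 := transition_diff apsi aphi dpsi dphi.
have d2' : differentiable (transition psi phi) (transition phi psi (phi p)).
  by rewrite (transition_at _ dphi).
have dc : differentiable (transition psi phi \o transition phi psi) (phi p) :=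
  differentiable_comp d1 d2'.
have e : 'd (transition psi phi \o transition phi psi) (phi p) v = v.
  rewrite -(deriveE _ dc) -[RHS](derive_id (phi p) v); apply: near_eq_derive.
  apply: filterS (near_chart_inv dphi (@chart_dom_open _ _ _ psi) dpsi) => x [ix dx].
  by rewrite /= /transition chart_mapK // chart_invK.
by rewrite (diff_comp d1 d2') /= (transition_at _ dphi) in e.
Qed.

Lemma tangent_of_coordK phi p (y : tangent p) : atlas phi -> chart_dom phi p ->
  tangent_of_coord phi p (tangent_coord phi y) = y.
Proof. by move=> aphi dp; apply: transition_diffK => //;
  [exact: chart_at_atlas|exact: chart_at_dom]. Qed.

Lemma tangent_coordK phi p v : atlas phi -> chart_dom phi p ->
  tangent_coord phi (tangent_of_coord phi p v) = v.
Proof. by move=> aphi dp; apply: transition_diffK => //;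
  [exact: chart_at_atlas|exact: chart_at_dom]. Qed.

Lemma tangent_coord_neq0 phi p (y : tangent p) : atlas phi -> chart_dom phi p -> y != 0 ->
  tangent_coord phi y != 0.
Proof.
move=> aphi dp; apply: contra => /eqP e.
by rewrite -(tangent_of_coordK y aphi dp) e /tangent_of_coord linear0.
Qed.

Lemma tangent_of_coord_neq0 phi p v : atlas phi -> chart_dom phi p -> v != 0 ->
  tangent_of_coord phi p v != 0.
Proof.
move=> aphi dp; apply: contra => /eqP e.
by rewrite -(tangent_coordK v aphi dp) e /tangent_coord linear0.
Qed.

Lemma tangent_of_coord_free phi p v u : atlas phi -> chart_dom phi p -> free [:: v; u] ->
  free [:: tangent_of_coord phi p v; tangent_of_coord phi p u].
Proof.
move=> aphi dp fvu; have v0 : v != 0 by apply: (free_not0 fvu); rewrite mem_head.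
apply/free2P; first exact: tangent_of_coord_neq0.
move=> a e; move/(free2P _ v0) : fvu => /(_ a); apply.
rewrite -(tangent_coordK u aphi dp) e /tangent_coord linearZ; congr (_ *: _).
exact: tangent_coordK.
Qed.

Lemma local_exprE (F : forall p : M, tangent p -> R) phi p v : chart_dom phi p ->
  local_expr F phi (phi p) v = F p (tangent_of_coord phi p v).
Proof. by move=> dp; rewrite /local_expr chart_mapK. Qed.

Lemma chart_imgP phi x : chart_img phi x -> exists2 p, chart_dom phi p & phi p = x.
Proof. by case=> p; exists p. Qed.

Variable c : M -> R.
Hypothesis c_smooth : smooth_function c.

Lemma dir_derivE phi p (y : tangent p) : atlas phi -> chart_dom phi p ->
  dir_deriv c phi y = 'd (c \o chart_inv phi) (phi p) (tangent_coord phi y).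
Proof.
move=> aphi dp; have dc := smooth_diff (c_smooth aphi) (chart_img_of dp).
rewrite [in RHS](row_sum_delta (tangent_coord phi y)) linear_sum; apply: eq_bigr => m _.
by rewrite linearZ mulrC /partial (deriveE _ dc).
Qed.

Lemma dir_deriv_chart phi p (y : tangent p) : atlas phi -> chart_dom phi p ->
  dir_deriv c phi y = dir_deriv c (chart_at p) y.
Proof.
have key psi : atlas psi -> chart_dom psi p ->
    dir_deriv c psi y = 'd (c \o chart_inv (chart_at p)) (chart_at p p) y.
  move=> apsi dp; have dq := chart_at_dom p; have aq := chart_at_atlas p.
  rewrite dir_derivE // /tangent_coord.
  have d1 := transition_diff aq apsi dq dp.
  have d2 := smooth_diff (c_smooth apsi) (chart_img_of dp).
  have d3 := smooth_diff (c_smooth aq) (chart_img_of dq).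
  have d2' : differentiable (c \o chart_inv psi) (transition (chart_at p) psi (chart_at p
    p)).
    by rewrite (transition_at _ dq).
  have dc := differentiable_comp d1 d2'.
  transitivity ('d ((c \o chart_inv psi) \o transition (chart_at p) psi) (chart_at p p) y).
    apply/esym; have := congr1 (@^~ y) (diff_comp d1 d2').
    by rewrite /= (transition_at _ dq).
  rewrite -(deriveE _ dc) -(deriveE _ d3); apply: near_eq_derive.
  apply: filterS (near_chart_inv dq (@chart_dom_open _ _ _ psi) dp) => x [ix dx].
  by rewrite /= /transition chart_mapK.
move=> aphi dp; rewrite key // key //; [exact: chart_at_atlas|exact: chart_at_dom].
Qed.

Lemma dir_derivN phi p (y : tangent p) : dir_deriv c phi (- y : tangent p) = - dir_deriv c
  phi y.
Proof.
rewrite /dir_deriv -sumrN; apply: eq_bigr => m _.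
by rewrite /tangent_coord linearN mxE mulrN.
Qed.

(** The mean value theorem on a segment inside a chart makes [c] locally constant; a level set is
    then open and closed in a connected space. *)
Lemma dir_deriv_eq0_const : (forall p (y : tangent p),
  y != 0 -> dir_deriv c (chart_at p) y = 0) ->
  exists c0, forall p, c p = c0.
Proof.
move=> dc0.
have dz phi p v : atlas phi -> chart_dom phi p -> 'd (c \o chart_inv phi) (phi p) v = 0.
  move=> aphi dp; have [->|v0] := eqVneq v 0; first exact: linear0.
  rewrite -(tangent_coordK v aphi dp) -dir_derivE // dir_deriv_chart //.
  by apply: dc0; exact: tangent_of_coord_neq0.
have loc p : \forall q \near p, c q = c p.
  pose phi := chart_at p; have dp : chart_dom phi p := chart_at_dom p.
  have aphi : atlas phi := chart_at_atlas p.
  have [e /= e0 He] : exists2 e : R, 0 < e & forall x, `|phi p - x| < e -> chart_img phi x.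
    have /nbhs_ballP[e /= e0 H] := open_near (@chart_img_open _ _ _ phi) (chart_img_of dp).
    by exists e => // x xe; apply: H; rewrite -ball_normE.
  have n1 : \forall q \near p, `|phi p - phi q| < e.
    by have /cvgrPdist_lt/(_ e e0) := chart_map_cont dp.
  have n2 : \forall q \near p, chart_dom phi q.
    by apply: open_nbhs_nbhs; split => //; exact: chart_dom_open.
  apply: filterS2 n1 n2 => q qe dq.
  have seg t : 0 <= t <= 1 -> chart_img phi (t *: (phi q - phi p) + phi p).
    move=> /andP[t0 t1]; apply: He; rewrite opprD addrCA subrr addr0 normrN normrZ
      ger0_norm //.
    by apply: le_lt_trans qe; rewrite distrC; exact: ler_piMl.
  have dd t : 0 <= t <= 1 -> differentiable (c \o chart_inv phi) (t *: (phi q - phi p) +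
    phi p).
    by move=> /seg; exact: smooth_diff (c_smooth aphi).
  have [|t /andP[/ltW t0 /ltW t1]] := @MVT_line R _ (c \o chart_inv phi) (phi p) (phi q -
    phi p) 1 ltr01.
    by move=> t /dd d; exact: diff_derivable.
  have t01 : 0 <= t <= 1 by rewrite t0 t1.
  have [p' dp' ep'] := chart_imgP (seg t t01).
  have dt := dd t t01; rewrite -ep' in dt *.
  rewrite (deriveE _ dt) dz // mulr0 scale1r subrK /= !chart_mapK //.
  by move=> /subr0_eq.
have [[p0 _]|h] := pselect (exists p : M, True); last first.
  by exists 0 => p; case: h; exists p.
exists (c p0) => p.
have -> // : [set q | c q = c p0] = setT -> c p = c p0.
  by move=> /seteqP[_ /(_ p I)].
apply: (@manifold_connected R n M); first by exists p0.
- exists [set q | c q = c p0]; last by rewrite setTI.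
  rewrite openE => q /= cq; apply: filterS (loc q) => z /= ->; exact: cq.
- exists [set q | c q = c p0]; last by rewrite setTI.
  rewrite -openC openE => q /= cq; apply: filterS (loc q) => z /= -> ; exact: cq.
Qed.

End Charts.

(** * Finsler manifolds *)

Section FinslerInChart.
Variables (R : realType) (n : nat) (n_ge2 : (2 <= n)%N).
Variables (M : manifold R n) (F : finsler M) (K : forall p : M, tangent p -> R).
Hypothesis K_flag : has_scalar_curvature F K.
Variables (c : M -> R) (c_smooth : smooth_function c).
Hypothesis S_isotropic : has_S_curvature F (fun p y => (n.+1)%:R * c p * F p y).

Let n_gt0 : (0 < n)%N := ltnW n_ge2.

Section OneChart.
Variables (phi : chart R n M) (aphi : atlas phi).
Local Notation U := (chart_img phi).
Local Notation L := (local_expr F phi).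

Let oU : open U := @chart_img_open R n M phi.

Lemma local_expr_smooth : smooth_on (slit U) (fun z => L z.1 z.2).
Proof. exact: finsler_smooth aphi. Qed.

Lemma local_expr_homog x y t : U x -> 0 < t -> L x (t *: y) = t * L x y.
Proof.
by move=> _ t0; rewrite /local_expr /tangent_of_coord linearZ finsler_homog.
Qed.

Lemma local_expr_ge0 x y : U x -> 0 <= L x y.
Proof. by move=> _; exact: finsler_ge0. Qed.

Lemma local_expr_posdef x (y u : 'rV[R]_n) : U x -> y != 0 -> u != 0 -> 0 < ginner L x y u
  u.
Proof. exact: finsler_posdef. Qed.

Lemma c_chart_smooth : smooth_on U (c \o chart_inv phi).
Proof. exact: c_smooth. Qed.

Lemma S_curvature_chart x (y : 'rV[R]_n) : U x -> y != 0 ->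
  S_curvature_is U L x y ((n.+1)%:R * (c \o chart_inv phi) x * L x y).
Proof.
move=> /chart_imgP[p dp <-] y0; rewrite local_exprE //= chart_mapK //.
have := S_isotropic aphi dp (tangent_of_coord_neq0 aphi dp y0).
by rewrite tangent_coordK.
Qed.

Definition K_chart (x y : 'rV[R]_n) : R := K (tangent_of_coord phi (chart_inv phi x) y).

Lemma K_chartE p y : chart_dom phi p -> K_chart (phi p) y = K (tangent_of_coord phi p y).
Proof. by move=> dp; rewrite /K_chart chart_mapK. Qed.

Lemma flag_chart x y u : U x -> free [:: y; u] -> flag_curvature L x y u = K_chart x y.
Proof.
move=> /chart_imgP[p dp <-] fyu; rewrite K_chartE //.
rewrite -(K_flag aphi dp (tangent_of_coord_free aphi dp fyu)).
by rewrite !tangent_coordK.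
Qed.

Definition reduced_K p (y : tangent p) : R := K y - 3 * (dir_deriv c phi y / F p y).

Lemma reduced_K_chart p (y : 'rV[R]_n) : chart_dom phi p ->
  reduced_K (tangent_of_coord phi p y) = K_chart (phi p) y -
    3 * ((\sum_m partial m (c \o chart_inv phi) (phi p) * y 0 m) / L (phi p) y).
Proof.
move=> dp; rewrite /reduced_K (K_chartE _ dp) (local_exprE _ _ dp).
rewrite /dir_deriv (tangent_coordK y aphi dp).
exact: erefl.
Qed.

Lemma reduced_K_const p (y1 y2 : tangent p) : chart_dom phi p -> y1 != 0 -> y2 != 0 ->
  reduced_K y1 = reduced_K y2.
Proof.
move=> dp y10 y20.
rewrite -(tangent_of_coordK y1 aphi dp) -(tangent_of_coordK y2 aphi dp) !reduced_K_chart //.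
apply: (isotropic_rigidity oU local_expr_smooth local_expr_homog local_expr_ge0
  local_expr_posdef n_gt0 c_chart_smooth S_curvature_chart n_ge2 flag_chart).
- exact: chart_img_of.
- exact: tangent_coord_neq0.
- exact: tangent_coord_neq0.
Qed.

Lemma F_gt0_chart p (y : tangent p) : chart_dom phi p -> y != 0 -> 0 < F p y.
Proof.
move=> dp y0; rewrite -(tangent_of_coordK y aphi dp) -local_exprE //.
apply: (metric_gt0 oU local_expr_smooth local_expr_homog local_expr_ge0
  local_expr_posdef); first exact: chart_img_of.
exact: tangent_coord_neq0.
Qed.

End OneChart.

Let e0 : 'rV[R]_n := delta_mx 0 (Ordinal n_gt0).

Definition curvature_base p : R := reduced_K (chart_at p) (e0 : tangent p).

Lemma reduced_K_indep phi p (y : tangent p) : atlas phi -> chart_dom phi p -> y != 0 ->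
  reduced_K phi y = curvature_base p.
Proof.
move=> aphi dp y0; rewrite /curvature_base -(reduced_K_const (chart_at_atlas p)
  (chart_at_dom p) y0 (delta_mx_neq0 R (Ordinal n_gt0))).
by rewrite /reduced_K (dir_deriv_chart c_smooth y aphi dp).
Qed.

(** [chart_at p] may vary with [p] without any continuity. Independence of chart and direction lets
    it be replaced, throughout a chart [phi], by [phi] and one of its coordinate vectors, where
    [local_sigma_smooth] applies. *)
Lemma curvature_base_smooth : smooth_function curvature_base.
Proof.
move=> phi aphi.
have oU : open (chart_img phi) := @chart_img_open R n M phi.
have e00 := delta_mx_neq0 R (Ordinal n_gt0).
have sm := local_sigma_smooth oU (local_expr_smooth aphi) (@local_expr_homog phi)
  (@local_expr_ge0 phi) (local_expr_posdef aphi)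
  n_ge2 (flag_chart aphi) (c_chart_smooth aphi) e00.
apply: (smooth_ext oU _ sm) => x /chart_imgP[p dp <-] /=.
rewrite -(reduced_K_chart aphi _ dp) chart_mapK //.
by apply: reduced_K_indep => //; exact: tangent_of_coord_neq0.
Qed.

Lemma curvature_formula phi p (y : tangent p) : atlas phi -> chart_dom phi p -> y != 0 ->
  K y = 3 * (dir_deriv c phi y / F p y) + curvature_base p.
Proof.
by move=> aphi dp y0; rewrite -(reduced_K_indep aphi dp y0) /reduced_K addrC subrK.
Qed.

Lemma dir_deriv_eq0 (kappa : M -> R) : (forall p (y : tangent p),
  y != 0 -> K y = kappa p) ->
  forall p (y : tangent p), y != 0 -> dir_deriv c (chart_at p) y = 0.
Proof.
move=> Kk p y y0; have aq := chart_at_atlas p; have dq := chart_at_dom p.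
have yN0 : (- y : tangent p) != 0 by rewrite oppr_eq0.
have e1 := curvature_formula aq dq y0; have e2 := curvature_formula aq dq yN0.
rewrite Kk // in e1; rewrite Kk // dir_derivN in e2.
have f1 := F_gt0_chart aq dq y0; have f2 := F_gt0_chart aq dq yN0.
move: (F p y) (F p (- y : tangent p)) (dir_deriv c (chart_at p) y) (curvature_base p)
  (kappa p) e1 e2 f1 f2.
move=> a b d s k e1 e2 a0 b0.
have an0 : a != 0 by rewrite gt_eqF.
have bn0 : b != 0 by rewrite gt_eqF.
(* F need not be reversible, so [a] and [b] may differ; their positivity alone forces [d = 0]. *)
have h1 : d / a + d / b = 0 by rewrite mulNr in e2; lra.
have : d * (a + b) = (d / a + d / b) * (a * b) by field; rewrite an0 bn0.
rewrite h1 mul0r => /eqP; rewrite mulf_eq0 => /orP[/eqP //|].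
by rewrite gt_eqF // addr_gt0.
Qed.

End FinslerInChart.

Theorem theorem1p1 (R : realType) (n : nat) (n_ge2 : (2 <= n)%N)
    (M : manifold R n) (F : finsler M)
    (K : forall p : M, tangent p -> R)
    (K_flag : has_scalar_curvature F K)
    (c : M -> R) (c_smooth : smooth_function c)
    (S_isotropic : has_S_curvature F (fun p y => (n.+1)%:R * c p * F p y)) :
  (exists sigma : M -> R, smooth_function sigma /\
     forall (p : M) (y : tangent p) (phi : chart R n M),
       atlas phi -> chart_dom phi p -> y != 0 ->
       K p y = 3 * (dir_deriv c phi y / F p y) + sigma p) /\
  ((exists c0 : R, forall p : M, c p = c0) <->
   (exists kappa : M -> R, smooth_function kappa /\
      forall (p : M) (y : tangent p), y != 0 -> K p y = kappa p)).
Proof.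
have sm := curvature_base_smooth n_ge2 K_flag c_smooth S_isotropic.
have formula := curvature_formula n_ge2 K_flag c_smooth S_isotropic.
split; first by exists (curvature_base n_ge2 F K c); split=> // p y phi; exact: formula.
split=> [[c0 cc]|[kappa [_ Kk]]].
  exists (curvature_base n_ge2 F K c); split=> // p y y0.
  rewrite (formula _ _ _ (chart_at_atlas p) (chart_at_dom p) y0).
  have -> : dir_deriv c (chart_at p) y = 0.
    rewrite /dir_deriv big1 // => m _.
    have -> : c \o chart_inv (chart_at p) = cst c0 by apply/funext => x /=; rewrite cc.
    by rewrite /partial derive_cst mul0r.
  by rewrite mul0r mulr0 add0r.
apply: (dir_deriv_eq0_const c_smooth).
exact: (dir_deriv_eq0 n_ge2 K_flag c_smooth S_isotropic Kk).
Qed.
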